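(* Let $E\subset\mathbb T$ be a nonempty closed set and let $q>0$ and $\epsilon>0$ be real numbers. There is a constant $c(q,\epsilon)>0$ such that the following holds. Let $f$ be holomorphic in $\mathbb D$ with $|f(0)|=1$ and suppose that for some constant $K>0$ $$\forall z\in\mathbb D,\quad \log^+|f(z)|\le \frac{K}{d(z,E)^q}.$$ Then $$\sum_{a\in Z(f)}(1-|a|^2)\,d(a,E)^{(q-\alpha(E)+\epsilon)_+}\le c(q,\epsilon)\,K .$$
   Context: $\mathbb D$ is the open unit disc of $\mathbb C$, $\mathbb T=\partial\mathbb D$, $d(z,E)$ is the euclidean distance from $z$ to $E$, $\log^+x=\max(\log x,0)$, $x_+=\max(x,0)$. $Z(f)$ is the set of zeros of $f$ in $\mathbb D$, counted with multiplicity. The Ahern–Clark type of $E$ is $$\alpha(E):=\sup\{\alpha\in\mathbb R:\ |\{t\in\mathbb T: d(t,E)<x\}|=O(x^\alpha),\ x\to+0\},$$ where $|A|$ denotes the Lebesgue measure of $A\subset\mathbb T$. *)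

(* Defs.v *)
From HB Require Import structures.
From mathcomp Require Import all_boot all_order all_algebra.
From mathcomp Require Import complex.
From mathcomp Require Import all_classical all_reals all_analysis.

Set Implicit Arguments.
Unset Strict Implicit.
Unset Printing Implicit Defensive.

Import Order.TTheory GRing.Theory Num.Theory.
Import numFieldNormedType.Exports.

Local Open Scope classical_set_scope.
Local Open Scope ring_scope.
Local Open Scope complex_scope.

Section Defs.
Variable R : realType.

(* [`|z|] is an element of [R[i]]; [normc] is its value in [R]. *)
Definition cabs (z : R[i]) : R := Normc.normc z.

Definition unit_disc : set R[i] := [set z | cabs z < 1].

Definition unit_circle : set R[i] := [set z | cabs z = 1].

(* [R[i]^o] carries the normed topology of the numeric field [R[i]], so this is
   complex differentiability at every point of the open set [unit_disc]. *)
Definition holomorphic_on_disc (f : R[i] -> R[i]) : Prop :=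
  forall z, unit_disc z -> derivable (f : R[i]^o -> R[i]^o) z 1.

Definition dist_to (z : R[i]) (E : set R[i]) : R :=
  inf [set cabs (z - w) | w in E].

(* [ln 0 = 0], so [logp 0 = 0], in agreement with [log 0 = -oo]. *)
Definition logp (x : R) : R := Num.max (ln x) 0.

(* Lebesgue measure of a subset of the unit circle, through the
   parametrization by arc length on [0, 2 pi[. *)
Definition circle_measure (A : set R[i]) : \bar R :=
  lebesgue_measure
    [set t : R | 0 <= t < pi *+ 2 /\ A (cos t +i* sin t)].

Definition ahern_clark_type (E : set R[i]) : R :=
  sup [set alpha : R |
    (fun x : R => fine (circle_measure
       [set t | unit_circle t /\ dist_to t E < x]) : R^o)
    =O_ (0^'+) (fun x : R => x `^ alpha : R^o)].

(* [zero_mult f a] is the largest [k] such that [(z - a) ^ k] divides [f] in the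
   ring of holomorphic functions on the disc ([+oo] if [f] vanishes
   identically). *)
Definition zero_mult (f : R[i] -> R[i]) (a : R[i]) : \bar R :=
  ereal_sup [set k%:R%:E | k in [set k : nat |
    exists2 g, holomorphic_on_disc g &
      forall z, unit_disc z -> f z = (z - a) ^+ k * g z]].

Definition zeros (f : R[i] -> R[i]) : set R[i] :=
  [set a | unit_disc a /\ f a = 0].

End Defs.

(* Main.v *)
Require Import Defs.
From mathcomp Require Import all_boot all_order all_algebra.
From mathcomp Require Import complex ring lra.
From mathcomp Require Import all_classical all_reals all_analysis measurable_realfun.

Set Implicit Arguments.
Unset Strict Implicit.
Unset Printing Implicit Defensive.

Import Order.TTheory GRing.Theory Num.Theory.
Import numFieldNormedType.Exports.

Local Open Scope classical_set_scope.
Local Open Scope ring_scope.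
Local Open Scope complex_scope.

(* Fix [t = 2 ^- n] and finitely many zeros [a] of [f], with multiplicities
   [m a], at distance at least [32 t] from [E]. Consider
     [G = f * prod_a ((1 - a^* z) / (z - a)) ^ m a * exp (- F)]
   on the part [dist (z, E) >= t / 2] of a disc slightly smaller than the unit
   disc. The real part of [F] is a sum of Poisson kernels with poles outside the
   disc, of two kinds: one kernel for each zero, at distance about [t], which
   cancels the Blaschke factor on [dist (z, E) = t / 2] but costs only half of
   [ln (1 / |a|)] at the origin; and one kernel for each of about [1 / t] equally
   spaced points of the circle, with weight [max (dist (., E), t) ^ - q], which
   dominates [K / dist (z, E) ^ q] where [1 - |z| <= t / 2]. The maximum
   principle, evaluated at [0], bounds the sum of [m a (1 - |a|^2)] by a
   Riemann sum of the weight, hence by [K] times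
   [sum_(j <= n) 2 ^ (j (q - alpha))] for every [alpha] close enough to the
   Ahern-Clark type of [E]. Summing over dyadic values of [t] gives the result.

   Only complex differentiability is assumed, so the maximum modulus principle
   rests on Goursat's bisection argument. *)

Local Notation Re := complex.Re.
Local Notation Im := complex.Im.

(** * Integrals of continuous functions over segments *)

Section SegmentIntegral.
Variable R : realType.
Notation mu := (@lebesgue_measure R).
Implicit Types (a b c e : R) (f g : R -> R).

Definition seg_int a b g : R := \int[mu]_(x in `[a, b]) g x.

Lemma seg_integrable a b g :
  (forall x, a <= x <= b -> {for x, continuous g}) ->
  mu.-integrable `[a, b] (EFin \o g).
Proof.
move=> cg; apply: continuous_compact_integrable; first exact: segment_compact.
by apply: continuous_in_subspaceT => x; rewrite inE/= in_itv/= => /cg.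
Qed.

Lemma seg_int_split a b c g : a <= b -> b <= c ->
  (forall x, a <= x <= c -> {for x, continuous g}) ->
  seg_int a c g = seg_int a b g + seg_int b c g.
Proof.
move=> ab bc cg; have ig := seg_integrable cg.
have := @Rintegral_itvB _ g (BLeft a) (BRight c) b ig.
rewrite !bnd_simp => /(_ ab bc).
rewrite Rintegral_itv_obnd_cbnd; last first.
  apply: integrableS ig => //; apply: subset_itvr.
  by rewrite bnd_simp.
by rewrite /seg_int => <-; rewrite subrKC.
Qed.

Lemma seg_int_cst a b c : a <= b -> seg_int a b (fun=> c) = c * (b - a).
Proof.
move=> ab; rewrite /seg_int Rintegral_cst//= lebesgue_measure_itv/= lte_fin.
by case: ltP => //= ba; congr (_ * _); apply/eqP; rewrite eq_sym subr_eq0 eq_le ba.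
Qed.

Lemma seg_int_le a b f g :
  (forall x, a <= x <= b -> {for x, continuous f}) ->
  (forall x, a <= x <= b -> {for x, continuous g}) ->
  (forall x, a <= x <= b -> f x <= g x) -> seg_int a b f <= seg_int a b g.
Proof.
by move=> cf cg fg; apply: le_Rintegral => //=; exact: seg_integrable.
Qed.

Lemma seg_int_dist a b c e f g : a <= b ->
  (forall x, a <= x <= b -> {for x, continuous f}) ->
  (forall x, a <= x <= b -> {for x, continuous g}) ->
  (forall x, a <= x <= b -> `|f x - g x - c| <= e) ->
  `|seg_int a b f - seg_int a b g - c * (b - a)| <= e * (b - a).
Proof.
move=> ab cf cg fg; rewrite /seg_int -RintegralB//; try exact: seg_integrable.
have cfg x : a <= x <= b -> {for x, continuous (fun y => f y - g y)}.
  by move=> xab; apply: (@continuousB _ _ _ f g x); [apply: cf|apply: cg].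
rewrite -/(seg_int a b (fun y => f y - g y)) ler_distl -mulrBl -mulrDl.
rewrite -!seg_int_cst//; apply/andP; split; apply: seg_int_le => //;
  try (by move=> *; apply: cst_continuous);
  by move=> x /fg; rewrite ler_distl => /andP[].
Qed.

End SegmentIntegral.

(** * Goursat's theorem on rectangles, in real coordinates *)

Section Goursat.
Variable R : realType.
Implicit Types (U V : R -> R -> R) (x y w h : R).

(* Real form of complex differentiability of [U + i V] at [x + i y]. *)
Definition cauchy_riemann U V x y := exists a b : R, forall e, 0 < e ->
  exists2 d, 0 < d & forall h k, `|h| < d -> `|k| < d ->
    `|U (x + h) (y + k) - U x y - (a * h - b * k)| <= e * (`|h| + `|k|) /\
    `|V (x + h) (y + k) - V x y - (b * h + a * k)| <= e * (`|h| + `|k|).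

Lemma cauchy_riemann_near U V x y : cauchy_riemann U V x y -> forall e, 0 < e ->
  exists2 d, 0 < d & forall h k, `|h| < d -> `|k| < d ->
    `|U (x + h) (y + k) - U x y| < e /\ `|V (x + h) (y + k) - V x y| < e.
Proof.
move=> [a [b cr]] e e0; have [d d0 H] := cr 1 ltr01.
pose M := 1 + `|a| + `|b|.
have M1 : 1 <= M by rewrite /M; have := normr_ge0 a; have := normr_ge0 b; lra.
exists (Num.min d (e / (2 * M + 1))).
  by rewrite lt_min d0 divr_gt0//; lra.
move=> h k; rewrite !lt_min !ltr_pdivlMr; [|lra..] => /andP[hd hM] /andP[kd kM].
have [HU HV] := H h k hd kd.
have h0 := normr_ge0 h; have k0 := normr_ge0 k.
have a0 := normr_ge0 a; have b0 := normr_ge0 b.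
have ah : `|a * h| <= `|a| * `|h| by rewrite normrM.
have bk : `|b * k| <= `|b| * `|k| by rewrite normrM.
have bh : `|b * h| <= `|b| * `|h| by rewrite normrM.
have ak : `|a * k| <= `|a| * `|k| by rewrite normrM.
have S : M * (`|h| + `|k|) < e by rewrite /M in hM kM *; nra.
split; apply: le_lt_trans S.
- have := ler_normD (U (x + h) (y + k) - U x y - (a * h - b * k)) (a * h - b * k).
  rewrite subrK; have := ler_normB (a * h) (b * k); rewrite /M; nra.
- have := ler_normD (V (x + h) (y + k) - V x y - (b * h + a * k)) (b * h + a * k).
  rewrite subrK; have := ler_normD (b * h) (a * k); rewrite /M; nra.
Qed.

Lemma cauchy_riemann_continuous U V x y : cauchy_riemann U V x y ->
  {for y, continuous (U x)} /\ {for x, continuous (fun x' => V x' y)}.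
Proof.
move=> /cauchy_riemann_near cr; split; apply/cvgrPdist_lt => e /cr[d d0 H].
- apply: filterS (nbhsx_ballx y d d0) => y'; rewrite /ball/= distrC => yd.
  by have := H 0 (y' - y); rewrite normr0 addr0 subrKC => -[] // + _; rewrite distrC.
- apply: filterS (nbhsx_ballx x d d0) => x'; rewrite /ball/= distrC => xd.
  by have := H (x' - x) 0; rewrite normr0 addr0 subrKC => -[] // _; rewrite distrC.
Qed.

(** The imaginary part of the contour integral of [U + i V], counterclockwise around [[x, x + w] x
    [y, y + h]]. *)
Definition rect_int U V x y w h :=
  seg_int y (y + h) (U (x + w)) - seg_int y (y + h) (U x)
  + (seg_int x (x + w) (fun s => V s y) - seg_int x (x + w) (fun s => V s (y + h))).

Definition cr_rect U V x y w h := forall x' y',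
  x <= x' <= x + w -> y <= y' <= y + h -> cauchy_riemann U V x' y'.

Lemma rect_int_quarter U V x y w h : 0 <= w -> 0 <= h -> cr_rect U V x y w h ->
  rect_int U V x y w h =
    rect_int U V x y (w / 2) (h / 2) + rect_int U V (x + w / 2) y (w / 2) (h / 2) +
    (rect_int U V x (y + h / 2) (w / 2) (h / 2) +
     rect_int U V (x + w / 2) (y + h / 2) (w / 2) (h / 2)).
Proof.
move=> w0 h0 cr; rewrite /rect_int.
have ex : x + w / 2 + w / 2 = x + w by lra.
have ey : y + h / 2 + h / 2 = y + h by lra.
rewrite !ex !ey.
have sU x' : x <= x' <= x + w ->
    seg_int y (y + h) (U x') =
    seg_int y (y + h / 2) (U x') + seg_int (y + h / 2) (y + h) (U x').
  move=> xx; apply: seg_int_split; [lra|lra|move=> s ys].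
  by have [] := cauchy_riemann_continuous (cr x' s xx ys).
have sV y' : y <= y' <= y + h ->
    seg_int x (x + w) (fun s => V s y') =
    seg_int x (x + w / 2) (fun s => V s y') + seg_int (x + w / 2) (x + w) (fun s => V s y').
  move=> yy; apply: seg_int_split; [lra|lra|move=> s xs].
  by have [] := cauchy_riemann_continuous (cr s y' xs yy).
rewrite !sU ?sV; try lra.
Qed.

Lemma nested_intervals (u : nat -> R) w : 0 <= w ->
  (forall n, u n <= u n.+1 /\ u n.+1 + w / 2 ^+ n.+1 <= u n + w / 2 ^+ n) ->
  exists X, forall n, u n <= X <= u n + w / 2 ^+ n.
Proof.
move=> w0 H.
have wn n : 0 <= w / 2 ^+ n by rewrite divr_ge0// exprn_ge0.
have up m n : u n <= u (m + n)%N by elim: m => // m IH; exact: le_trans IH (H _).1.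
have dn m n : u (m + n)%N + w / 2 ^+ (m + n) <= u n + w / 2 ^+ n.
  by elim: m => // m IH; apply: le_trans IH; exact: (H _).2.
have ub m n : u m <= u n + w / 2 ^+ n.
  by have := dn m n; have := up n m; rewrite addnC; have := wn (m + n)%N; lra.
have hs : has_sup (range u).
  by split; [exists (u 0%N), 0%N|exists (u 0%N + w / 2 ^+ 0) => _ [m _ <-]].
exists (sup (range u)) => n; apply/andP; split.
  by apply: (sup_upper_bound hs); exists n.
by apply: ge_sup; [exact: hs.1|move=> _ [m _ <-]].
Qed.

(** The affine part of [U + i V] at [(X, Y)] contributes [a w h] through the vertical sides and
    [- a h w] through the horizontal ones, hence nothing. The remainder is at most [e (w + h)] at
    each boundary point, so two opposite sides cost at most [2 e (w + h)] times their length. *)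
Lemma rect_int_small U V X Y e w0 h0 : 0 < e -> cauchy_riemann U V X Y ->
  0 <= w0 -> 0 <= h0 ->
  exists N, forall n, (N <= n)%N -> forall x y,
    let w := w0 / 2 ^+ n in let h := h0 / 2 ^+ n in
    x <= X <= x + w -> y <= Y <= y + h -> cr_rect U V x y w h ->
    `|rect_int U V x y w h| <= 2 * e * (w + h) ^+ 2.
Proof.
move=> e0 [a [b cr]] w00 h00; have [d d0 H] := cr e e0.
have [N HN] : exists N, (w0 + h0) < d * 2 ^+ N.
  pose N := Num.truncn ((w0 + h0) / d); exists N.+1.
  rewrite mulrC -ltr_pdivrMr//; apply: lt_trans (truncnS_gt _) _.
  by rewrite -natrX ltr_nat ltn_expl.
exists N => n Nn x y w h xX yY crr.
have hw : w + h < d.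
  rewrite -mulrDl ltr_pdivrMr ?exprn_gt0//; apply: lt_le_trans HN _.
  by rewrite ler_wpM2l// ?(ltW d0)// ler_weXn2l// ler1n.
have wge0 : 0 <= w by rewrite divr_ge0// exprn_ge0.
have hge0 : 0 <= h by rewrite divr_ge0// exprn_ge0.
have K x' y' : x <= x' <= x + w -> y <= y' <= y + h ->
  `|U x' y' - U X Y - (a * (x' - X) - b * (y' - Y))| <= e * (w + h) /\
  `|V x' y' - V X Y - (b * (x' - X) + a * (y' - Y))| <= e * (w + h).
  move=> xx yy.
  have hx : `|x' - X| <= w by rewrite ler_norml; lra.
  have hy : `|y' - Y| <= h by rewrite ler_norml; lra.
  have := H (x' - X) (y' - Y); rewrite !subrKC => -[||HU HV]; [lra|lra|].
  by split; [apply: le_trans HU _|apply: le_trans HV _]; rewrite ler_pM2l//; lra.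
have BU : `|seg_int y (y + h) (U (x + w)) - seg_int y (y + h) (U x) - a * w * (y + h - y)|
    <= (2 * e * (w + h)) * (y + h - y).
  apply: seg_int_dist; first lra.
  - by move=> s ys; have [] := cauchy_riemann_continuous (crr (x + w) s ltac:(lra) ys).
  - by move=> s ys; have [] := cauchy_riemann_continuous (crr x s ltac:(lra) ys).
  move=> s ys; have [K1 _] := K (x + w) s ltac:(lra) ys.
  have [K2 _] := K x s ltac:(lra) ys.
  move: K1 K2; rewrite !ler_norml; lra.
have BV : `|seg_int x (x + w) (fun s => V s y) - seg_int x (x + w) (fun s => V s (y + h))
     - (- a * h) * (x + w - x)|
    <= (2 * e * (w + h)) * (x + w - x).
  apply: seg_int_dist; first lra.
  - by move=> s xs; have [] := cauchy_riemann_continuous (crr s y xs ltac:(lra)).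
  - by move=> s xs; have [] := cauchy_riemann_continuous (crr s (y + h) xs ltac:(lra)).
  move=> s xs; have [_ K1] := K s (y + h) xs ltac:(lra).
  have [_ K2] := K s y xs ltac:(lra).
  move: K1 K2; rewrite !ler_norml; lra.
move: BU BV; rewrite /rect_int !ler_norml; nra.
Qed.

(** Bisection: at each stage one of the four quarters keeps at least a quarter of the modulus of the
    integral, whereas around the limit point of the nested rectangles [rect_int_small] makes it an
    arbitrarily small multiple of [(w + h) ^ 2 / 4 ^ n]. *)
Lemma goursat U V x y w h : 0 <= w -> 0 <= h -> cr_rect U V x y w h ->
  rect_int U V x y w h = 0.
Proof.
move=> w0 h0 cr; apply/eqP/negPn/negP => T0.
set T := `|rect_int U V x y w h|.
have Tgt0 : 0 < T by rewrite normr_gt0.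
pose wn n := w / 2 ^+ n; pose hn n := h / 2 ^+ n.
have wn0 n : 0 <= wn n by rewrite divr_ge0// exprn_ge0.
have hn0 n : 0 <= hn n by rewrite divr_ge0// exprn_ge0.
have wS n : wn n.+1 = wn n / 2 by rewrite /wn exprSr invfM mulrA.
have hS n : hn n.+1 = hn n / 2 by rewrite /hn exprSr invfM mulrA.
pose inv n (p : R * R) := [/\ x <= p.1, p.1 + wn n <= x + w, y <= p.2,
  p.2 + hn n <= y + h & T / 4 ^+ n <= `|rect_int U V p.1 p.2 (wn n) (hn n)|].
pose nest n (p p' : R * R) := [/\ p.1 <= p'.1, p'.1 + wn n.+1 <= p.1 + wn n,
  p.2 <= p'.2 & p'.2 + hn n.+1 <= p.2 + hn n].
have crn n p : inv n p -> cr_rect U V p.1 p.2 (wn n) (hn n).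
  by case=> ? ? ? ? _ x' y' xx yy; apply: cr; lra.
(* The selection map is defined on all pairs; [(0, 0)] is a dummy value for those that violate
   [inv]. *)
have /choice[s Hs] : forall q : nat * (R * R), exists p', inv q.1 q.2 ->
    inv q.1.+1 p' /\ nest q.1 q.2 p'.
  move=> [n [u v]]; have [I|] := pselect (inv n (u, v)); last by exists (0, 0).
  have [/= i1 i2 i3 i4 i5] := I.
  have wn' := wn0 n; have hn' := hn0 n.
  have [p' [np' Tp']] : exists p', nest n (u, v) p' /\
      T / 4 ^+ n.+1 <= `|rect_int U V p'.1 p'.2 (wn n.+1) (hn n.+1)|.
    have := rect_int_quarter (wn0 n) (hn0 n) (crn _ _ I); rewrite /= -!wS -!hS => E.
    rewrite E in i5; rewrite exprSr invfM mulrA.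
    apply: contrapT => /forallNP F.
    have G p' : nest n (u, v) p' ->
        `|rect_int U V p'.1 p'.2 (wn n.+1) (hn n.+1)| < T / 4 ^+ n / 4.
      by move=> np; rewrite ltNge; apply/negP => le; exact: (F p').
    have := G (u, v) ltac:(rewrite /nest/= !wS !hS; split; lra).
    have := G (u + wn n.+1, v) ltac:(rewrite /nest/= !wS !hS; split; lra).
    have := G (u, v + hn n.+1) ltac:(rewrite /nest/= !wS !hS; split; lra).
    have := G (u + wn n.+1, v + hn n.+1) ltac:(rewrite /nest/= !wS !hS; split; lra).
    rewrite /=.
    set a1 := rect_int _ _ _ _ _ _; set a2 := rect_int _ _ _ _ _ _.
    set a3 := rect_int _ _ _ _ _ _; set a4 := rect_int _ _ _ _ _ _.
    rewrite -/a1 -/a2 -/a3 -/a4 in i5; move: i5; set X := T / 4 ^+ n.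
    have := ler_normD (a4 + a3) (a2 + a1); have := ler_normD a4 a3.
    have := ler_normD a2 a1; lra.
  exists p' => _; split => //.
  by have [/= ? ? ? ?] := np'; split => //=; lra.
pose p := fix p n := if n is m.+1 then s (m, p m) else (x, y).
have Ip n : inv n (p n).
  elim: n => [|n IH] /=; last by have [] := Hs (n, p n) IH.
  by split => /=; rewrite /wn /hn ?expr0 ?divr1.
have Np n : nest n (p n) (p n.+1) by have [] := Hs (n, p n) (Ip n).
have [X HX] := @nested_intervals (fun n => (p n).1) w w0
  (fun n => let: And4 a b _ _ := Np n in conj a b).
have [Y HY] := @nested_intervals (fun n => (p n).2) h h0
  (fun n => let: And4 _ _ a b := Np n in conj a b).
have crX : cauchy_riemann U V X Y.
  by have := HX 0%N; have := HY 0%N; rewrite /= expr0 !divr1 => ? ?; exact: cr.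
have H e : 0 < e -> T <= 2 * e * (w + h) ^+ 2.
  move=> e0; have [N HN] := rect_int_small e0 crX w0 h0.
  have := HN N (leqnn N) _ _ (HX N) (HY N) (crn _ _ (Ip N)).
  have [_ _ _ _] := Ip N; rewrite -/(wn N) -/(hn N) => T1 T2.
  have := le_trans T1 T2; rewrite ler_pdivrMr ?exprn_gt0// => /le_trans; apply.
  have -> : 4 ^+ N = (2 ^+ N) ^+ 2 :> R by rewrite -exprM mulnC exprM; congr (_ ^+ _); ring.
  rewrite le_eqVlt; apply/orP; left; apply/eqP; rewrite /wn /hn.
  by field; rewrite expf_neq0.
(* With [e = T / (2 M)] the bound [H] reads [T <= T (w + h) ^ 2 / M], while [(w + h) ^ 2 < M]. The
   added 1 keeps [M] positive for a degenerate rectangle. *)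
pose M := 2 * (w + h) ^+ 2 + 1.
have M0 : 0 < M by rewrite /M; have := sqr_ge0 (w + h); lra.
have := H (T / (2 * M)) ltac:(by rewrite divr_gt0// mulr_gt0).
have -> : 2 * (T / (2 * M)) * (w + h) ^+ 2 = T * (((w + h) ^+ 2) / M) by field; lra.
suff : (w + h) ^+ 2 / M < 1 by nra.
by rewrite ltr_pdivrMr// mul1r /M; have := sqr_ge0 (w + h); lra.
Qed.

End Goursat.

(** * The modulus of complex numbers *)

Section ComplexModulus.
Variable R : realType.
Implicit Types z w : R[i].

Lemma cabsE z : `|z| = (cabs z)%:C. Proof. by []. Qed.

Lemma cabs_ge0 z : 0 <= cabs z.
Proof. by case: z => a b; rewrite /cabs/= sqrtr_ge0. Qed.

Lemma cabs0 : cabs (0 : R[i]) = 0. Proof. exact: Normc.normc0. Qed.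

Lemma cabs1 : cabs (1 : R[i]) = 1. Proof. exact: Normc.normc1. Qed.

Lemma cabsM z w : cabs (z * w) = cabs z * cabs w. Proof. exact: Normc.normcM. Qed.

Lemma cabsV z : cabs z^-1 = (cabs z)^-1. Proof. exact: Normc.normcV. Qed.

Lemma cabsD z w : cabs (z + w) <= cabs z + cabs w. Proof. exact: le_normcD. Qed.

Lemma cabsN z : cabs (- z) = cabs z. Proof. exact: normcN. Qed.

Lemma cabsB z w : cabs (z - w) = cabs (w - z). Proof. by rewrite -cabsN opprB. Qed.

Lemma cabsX z n : cabs (z ^+ n) = cabs z ^+ n.
Proof. by elim: n => [|n IH]; rewrite ?cabs1// !exprS cabsM IH. Qed.

Lemma cabs_prod (I : Type) (s : seq I) (F : I -> R[i]) :
  cabs (\prod_(i <- s) F i) = \prod_(i <- s) cabs (F i).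
Proof. exact: (big_morph _ cabsM cabs1). Qed.

Lemma cabs_eq0 z : (cabs z == 0) = (z == 0).
Proof. by apply/eqP/eqP => [/Normc.eq0_normc//|->]; rewrite cabs0. Qed.

Lemma cabs_gt0 z : (0 < cabs z) = (z != 0).
Proof. by rewrite lt_def cabs_ge0 cabs_eq0 andbT. Qed.

Lemma cabs_real (x : R) : cabs x%:C = `|x|.
Proof. by rewrite /cabs/= expr0n/= addr0 sqrtr_sqr. Qed.

Lemma sqr_cabs z : cabs z ^+ 2 = Re z ^+ 2 + Im z ^+ 2.
Proof. by case: z => a b; rewrite /cabs/= sqr_sqrtr// addr_ge0// sqr_ge0. Qed.

Lemma cabs_conj z : cabs z^*%C = cabs z.
Proof. by case: z => a b; rewrite /cabs/= sqrrN. Qed.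

Lemma normRe_le z : `|Re z| <= cabs z.
Proof.
rewrite -ler_sqr ?nnegrE ?cabs_ge0// real_normK ?num_real// sqr_cabs.
by rewrite lerDl sqr_ge0.
Qed.

Lemma normIm_le z : `|Im z| <= cabs z.
Proof.
rewrite -ler_sqr ?nnegrE ?cabs_ge0// real_normK ?num_real// sqr_cabs.
by rewrite lerDr sqr_ge0.
Qed.

Lemma Re_le z : Re z <= cabs z.
Proof. exact: le_trans (ler_norm _) (normRe_le z). Qed.

Lemma cabs_le z : cabs z <= `|Re z| + `|Im z|.
Proof.
rewrite -ler_sqr ?nnegrE ?cabs_ge0 ?addr_ge0// sqr_cabs sqrrD.
rewrite !real_normK ?num_real//.
by have := mulr_ge0 (normr_ge0 (Re z)) (normr_ge0 (Im z)); lra.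
Qed.

Lemma cabs_triangle z w v : cabs (z - v) <= cabs (z - w) + cabs (w - v).
Proof. by apply: le_trans (cabsD _ _); rewrite addrA subrK. Qed.

Lemma cabs_leBD z w : cabs z <= cabs (z - w) + cabs w.
Proof. by apply: le_trans (cabsD _ _); rewrite subrK. Qed.

(** Positivity in the partial order of [R[i]] forces a zero imaginary part. Tolerances in [R[i]] are
    thereby exchanged for tolerances in [R]. *)
Lemma complex_gt0 (e : R[i]) : 0 < e -> 0 < Re e /\ e = (Re e)%:C.
Proof. by case: e => a b; rewrite ltcE/= => /andP[/eqP-> ->]. Qed.

End ComplexModulus.

(** * Complex differentiability *)

Section Derivative.

(** A form without division, meaningful at [h = 0]. The general field [K] serves both the real
    functions [expR], [sin], [cos] and the functions of a complex variable. *)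
Definition has_derivative (K : numFieldType) (f : K -> K) (x l : K) :=
  forall e : K, 0 < e -> exists2 d : K, 0 < d & forall h : K, `|h| < d ->
    `|f (x + h) - f x - l * h| <= e * `|h|.

Lemma is_derive_has_derivative (K : numFieldType) (f : K^o -> K^o) (x l : K^o) :
  is_derive x 1 f l -> has_derivative f x l.
Proof.
move=> [df dl] e e0; have := df; rewrite /derivable => {}df.
have : (h^-1 *: ((f \o shift x) (h *: 1) - f x) @[h --> 0^'] --> l) by rewrite -dl.
move/cvgrPdist_le => /(_ e e0)[d /= d0 H].
exists d => // h hd; have [->|h0] := eqVneq h 0.
  by rewrite addr0 subrr mulr0 subr0 !normr0 mulr0.
have := H h; rewrite /= sub0r normrN => /(_ hd h0) {}H.
have -> : f (x + h) - f x - l * h = - ((l - h^-1 *: (f (h *: 1 + x) - f x)) * h).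
  rewrite -[h *: 1]/(h * 1) -[h^-1 *: _]/(h^-1 * _) mulr1 [h + x]addrC.
  by rewrite mulrBl mulrAC mulVf// mul1r opprB.
by rewrite normrN normrM ler_wpM2r.
Qed.

Lemma derivableE (K : numFieldType) (f : K^o -> K^o) (x : K^o) :
  derivable f x 1 <-> exists l, has_derivative f x l.
Proof.
split.
- by move=> /derivableP/is_derive_has_derivative H; exists ('D_1 f x).
- move=> [l H]; apply/cvg_ex; exists l; apply/cvgrPdist_le => e e0.
  have [d d0 {}H] := H e e0; exists d => // h; rewrite /= sub0r normrN => hd h0 /=.
  have := H h hd.
  rewrite -[h *: 1]/(h * 1) -[h^-1 *: _]/(h^-1 * _) mulr1 [h + x]addrC => {}H.
  rewrite -(ler_pM2r (x := `|h|)) ?normr_gt0// -normrM mulrBl mulrAC mulVf// mul1r.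
  by rewrite distrC.
Qed.

Variable R : realType.
Implicit Types (f g : R[i] -> R[i]) (z : R[i]).

(* Complex differentiability in terms of the real-valued modulus: the norm of
   [R[i]], in which [derivable] is stated, takes its values in [R[i]]. *)
Definition cdiff f z := exists l : R[i], forall e : R, 0 < e ->
  exists2 d : R, 0 < d & forall h, cabs h < d ->
    cabs (f (z + h) - f z - l * h) <= e * cabs h.

Lemma cdiffE f z : cdiff f z <-> derivable (f : R[i]^o -> R[i]^o) z 1.
Proof.
rewrite derivableE; split=> -[l H]; exists l => e e0.
- have [e0' ->] := complex_gt0 e0; have [d d0 {}H] := H _ e0'.
  exists d%:C; first by rewrite ltcR.
  move=> h; rewrite !cabsE ltcR => /H.
  by rewrite -rmorphM lecR.
- have [|d /complex_gt0[d0 ->] {}H] := H e%:C; first by rewrite ltcR.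
  exists (Re d) => // h hd; have := H h; rewrite !cabsE ltcR => /(_ hd).
  by rewrite -rmorphM lecR.
Qed.

Lemma cdiff_cst c z : cdiff (fun=> c) z.
Proof. by apply/cdiffE; exact: derivable_cst. Qed.

Lemma cdiff_id z : cdiff id z.
Proof. by apply/cdiffE; exact: derivable_id. Qed.

Lemma cdiffD f g z : cdiff f z -> cdiff g z -> cdiff (fun z => f z + g z) z.
Proof. by move=> /cdiffE df /cdiffE dg; apply/cdiffE; exact: derivableD. Qed.

Lemma cdiffB f g z : cdiff f z -> cdiff g z -> cdiff (fun z => f z - g z) z.
Proof. by move=> /cdiffE df /cdiffE dg; apply/cdiffE; exact: derivableB. Qed.

Lemma cdiffM f g z : cdiff f z -> cdiff g z -> cdiff (fun z => f z * g z) z.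
Proof.
move=> /cdiffE df /cdiffE dg; apply/cdiffE.
exact (@derivableM _ _ (f : R[i]^o -> R[i]) g z 1 df dg).
Qed.

Lemma cdiffV f z : f z != 0 -> cdiff f z -> cdiff (fun z => (f z)^-1) z.
Proof.
move=> fz /cdiffE df; apply/cdiffE.
exact (@derivableV _ _ (f : R[i]^o -> R[i]) z 1 fz df).
Qed.

Lemma cdiffX f n z : cdiff f z -> cdiff (fun z => f z ^+ n) z.
Proof.
move=> df; elim: n => [|n IH]; first exact: cdiff_cst.
by under eq_fun do rewrite exprS; exact: cdiffM.
Qed.

Lemma cdiff_sum (I : Type) (s : seq I) (F : I -> R[i] -> R[i]) z :
  (forall i, cdiff (F i) z) -> cdiff (fun z => \sum_(i <- s) F i z) z.
Proof.
move=> dF; elim: s => [|i s IH].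
  by under eq_fun do rewrite big_nil; exact: cdiff_cst.
have -> : (fun z => \sum_(j <- i :: s) F j z) = (fun z => F i z + \sum_(j <- s) F j z).
  by apply/funext => x; rewrite big_cons.
exact (cdiffD (dF i) IH).
Qed.

Lemma cdiff_prod (I : Type) (s : seq I) (F : I -> R[i] -> R[i]) z :
  (forall i, cdiff (F i) z) -> cdiff (fun z => \prod_(i <- s) F i z) z.
Proof.
move=> dF; elim: s => [|i s IH].
  by under eq_fun do rewrite big_nil; exact: cdiff_cst.
have -> : (fun z => \prod_(j <- i :: s) F j z) = (fun z => F i z * \prod_(j <- s) F j z).
  by apply/funext => x; rewrite big_cons.
exact (cdiffM (dF i) IH).
Qed.

Lemma cdiff_comp f g z : cdiff f z -> cdiff g (f z) -> cdiff (fun z => g (f z)) z.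
Proof.
move=> /cdiffE/derivable1_diffP df /cdiffE/derivable1_diffP dg.
apply/cdiffE/derivable1_diffP.
exact: (@differentiable_comp _ _ _ _ (f : R[i]^o -> R[i]^o) (g : R[i]^o -> R[i]^o) z df dg).
Qed.

Lemma cdiff_near f g z (d : R) : 0 < d ->
  (forall w, cabs (w - z) < d -> f w = g w) -> cdiff g z -> cdiff f z.
Proof.
move=> d0 fg [l H]; exists l => e /H[d' d'0 {}H].
exists (Num.min d d'); first by rewrite lt_min d0.
move=> h; rewrite lt_min => /andP[hd /H].
by rewrite !fg// ?subrr ?cabs0// addrAC subrr add0r.
Qed.

Lemma cdiff_near_cabs f z e : cdiff f z -> 0 < e ->
  exists2 d : R, 0 < d & forall w, cabs (w - z) < d -> cabs (f w - f z) < e.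
Proof.
move=> [l /(_ 1 ltr01)[d d0 H]] e0.
have l0 := cabs_ge0 l.
exists (Num.min d (e / (2 + cabs l))); first by rewrite lt_min d0 divr_gt0//; lra.
move=> w; rewrite lt_min ltr_pdivlMr; last lra.
move=> /andP[/H]; rewrite subrKC mul1r => H1 H2.
have := cabs_leBD (f w - f z) (l * (w - z)); rewrite cabsM.
have := cabs_ge0 (w - z); nra.
Qed.

Lemma holomorphic_cdiff f : holomorphic_on_disc f <-> forall z, cabs z < 1 -> cdiff f z.
Proof. by split=> df z /df/cdiffE. Qed.

End Derivative.

(** * The complex exponential *)

Section ComplexExponential.
Variable R : realType.
Implicit Types z w : R[i].

Definition cexp z : R[i] :=
  (expR (Re z) * cos (Im z)) +i* (expR (Re z) * sin (Im z)).

Lemma cexpD z w : cexp (z + w) = cexp z * cexp w.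
Proof.
case: z w => [a b] [c d]; rewrite /cexp/= expRD cosD sinD.
by apply/eqP; rewrite eq_complex/=; apply/andP; split; apply/eqP; ring.
Qed.

Lemma cabs_cexp z : cabs (cexp z) = expR (Re z).
Proof.
apply/eqP; rewrite -(eqrXn2 (n := 2)) ?cabs_ge0 ?expR_ge0// sqr_cabs/=.
by rewrite !exprMn -mulrDr cos2Dsin2 mulr1.
Qed.

(** By [cexpD] the error term is [cexp z] times [cexp h - 1 - h], so only the real derivatives of
    [expR], [sin] and [cos] at 0 enter. *)
Lemma cdiff_cexp z : cdiff cexp z.
Proof.
exists (cexp z) => e e0.
have E := expR_gt0 (Re z).
(* The real part of [cexp h - 1 - h] will be at most [4 e' |h|] and the imaginary part at most
   [5 e' |h|]; 10 covers both. The cap 1 ensures [expR (Re h) <= 3]. *)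
pose e' := Num.min 1 (e / (expR (Re z) * 10)).
have e'0 : 0 < e' by rewrite lt_min ltr01 divr_gt0// mulr_gt0.
have e'1 : e' <= 1 by rewrite ge_min lexx.
have e'e : expR (Re z) * (10 * e') <= e.
  have X0 : 0 < expR (Re z) * 10 by rewrite mulr_gt0.
  by rewrite mulrA mulrC -ler_pdivlMr// /e' ge_min lexx orbT.
have := is_derive_has_derivative (is_derive_expR (0 : R)); rewrite expR0.
move=> /(_ e' e'0)[d1 d10 H1].
have := is_derive_has_derivative (is_derive_sin (0 : R)); rewrite cos0.
move=> /(_ e' e'0)[d2 d20 H2].
have := is_derive_has_derivative (is_derive_cos (0 : R)); rewrite sin0 oppr0.
move=> /(_ e' e'0)[d3 d30 H3].
exists (Num.min (Num.min d1 d2) (Num.min d3 e')).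
  by rewrite 3!lt_min d10 d20 d30 e'0.
move=> h; rewrite 3!lt_min => /andP[/andP[hd1 hd2] /andP[hd3 hd4]].
have -> : cexp (z + h) - cexp z - cexp z * h = cexp z * (cexp h - 1 - h).
  by rewrite cexpD; ring.
rewrite cabsM cabs_cexp; have h0 := cabs_ge0 h.
suff : cabs (cexp h - 1 - h) <= 10 * e' * cabs h by nra.
have hx := normRe_le h; have hy := normIm_le h.
have {H1} := H1 (Re h); have {H2} := H2 (Im h); have {H3} := H3 (Im h).
rewrite !add0r expR0 sin0 cos0 !mul1r mul0r !subr0.
move=> /(_ (le_lt_trans hy hd3)) H3 /(_ (le_lt_trans hy hd2)) H2 /(_ (le_lt_trans hx hd1)) H1.
apply: le_trans (cabs_le _) _.
have -> : Re (cexp h - 1 - h) = expR (Re h) * cos (Im h) - 1 - Re h by case: (h).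
have -> : Im (cexp h - 1 - h) = expR (Re h) * sin (Im h) - Im h.
  by case: (h) => a b /=; rewrite oppr0 addr0.
move: (Re h) (Im h) (cabs h) h0 hd4 hx hy H1 H2 H3 => x y n n0 hn hx hy H1 H2 H3.
have x0 := normr_ge0 x; have y0 := normr_ge0 y.
have B1 : `|expR x - 1| <= 2 * n.
  have := ler_normD (expR x - 1 - x) x; rewrite subrK; nra.
have B2 : expR x <= 3 by have := ler_norm (expR x - 1); nra.
have E0 := expR_ge0 x.
have -> : expR x * cos y - 1 - x = (expR x - 1 - x) + expR x * (cos y - 1) by ring.
have -> : expR x * sin y - y = expR x * (sin y - y) + (expR x - 1) * y by ring.
have T1 := ler_normD (expR x - 1 - x) (expR x * (cos y - 1)).
have T2 := ler_normD (expR x * (sin y - y)) ((expR x - 1) * y).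
rewrite !normrM (ger0_norm E0) in T1 T2.
have X1 : `|expR x - 1 - x| <= e' * n by nra.
have X2 : `|cos y - 1| <= e' * n by nra.
have X3 : `|sin y - y| <= e' * n by nra.
have X4 : expR x * `|cos y - 1| <= 3 * (e' * n) by apply: ler_pM.
have X5 : expR x * `|sin y - y| <= 3 * (e' * n) by apply: ler_pM.
have X6 : `|expR x - 1| * `|y| <= (2 * n) * e'.
  by apply: ler_pM => //; apply: le_trans hy (ltW hn).
have := mulr_ge0 (ltW e'0) n0; lra.
Qed.

End ComplexExponential.

(** * Circle means and the maximum modulus principle *)

Section MaximumModulus.
Variable R : realType.
Implicit Types (f g : R[i] -> R[i]) (z w : R[i]).

Lemma cdiff_cauchy_riemann f (x y : R) : cdiff f (x +i* y) ->
  cauchy_riemann (fun x y => Re (f (x +i* y))) (fun x y => Im (f (x +i* y))) x y.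
Proof.
move=> [[a b] H]; exists a, b => e e0; have [d d0 {}H] := H e e0.
exists (d / 2); first by rewrite divr_gt0.
move=> h k hd kd.
have hk : cabs (h +i* k) <= `|h| + `|k| by exact: cabs_le.
have := H (h +i* k) ltac:(lra).
set D := f _ - f _ - _ => HD.
have E : cabs D <= e * (`|h| + `|k|).
  by apply: le_trans HD _; rewrite ler_pM2l.
split; [apply: le_trans E; apply: le_trans (normRe_le D)|
        apply: le_trans E; apply: le_trans (normIm_le D)].
- rewrite /D -[(x +i* y) + (h +i* k)]/((x + h) +i* (y + k)).
  by case: (f _) => ? ?; case: (f _) => ? ?.
- rewrite /D -[(x +i* y) + (h +i* k)]/((x + h) +i* (y + k)).
  by case: (f _) => ? ?; case: (f _) => ? ? /=; rewrite [a * k + _]addrC.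
Qed.

(* With [F w = f (z0 + exp w)], Goursat on [[s, ln r] x [0, 2 pi]] shows that the
   mean of [f] over the circle of radius [exp s] does not depend on [s]: the two
   horizontal sides cancel by periodicity. *)
Lemma circle_mean_le f z0 r (eta : R) : 0 < r -> 0 < eta ->
  (forall z, cabs (z - z0) <= r -> cdiff f z) ->
  ~ (forall z, cabs (z - z0) = r -> Re (f z) <= Re (f z0) - eta).
Proof.
move=> r0 eta0 df fr.
pose F w := f (z0 + cexp w).
pose U (x y : R) := Re (F (x +i* y)); pose V (x y : R) := Im (F (x +i* y)).
have absF x y : cabs (z0 + cexp (x +i* y) - z0) = expR x.
  by rewrite addrC addKr cabs_cexp.
have dF x y : x <= ln r -> cauchy_riemann U V x y.
  move=> xr; apply: cdiff_cauchy_riemann; apply: (@cdiff_comp _ (fun w => z0 + cexp w)).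
    apply: cdiffD; [exact: cdiff_cst|exact: cdiff_cexp].
  by apply: df; rewrite absF -(lnK (x := r))// ler_expR.
have [d d0 Hd] : exists2 d : R, 0 < d & forall z, cabs (z - z0) < d ->
    cabs (f z - f z0) < eta / 2.
  by apply: cdiff_near_cabs; [apply: df; rewrite subrr cabs0 ltW|rewrite divr_gt0].
(* On the circle of radius [expR s <= d / 2], [f] stays within [eta / 2] of [f z0]. Equal means then
   contradict a drop by [eta] on the circle of radius [r]. *)
pose s := Num.min (ln (d / 2)) (ln r).
have sr : s <= ln r by rewrite ge_min lexx orbT.
have sd : expR s < d.
  apply: (@le_lt_trans _ _ (d / 2)); last lra.
  by rewrite -[leRHS](lnK) ?posrE ?divr_gt0// ler_expR ge_min lexx.
have pi2 : 0 < pi *+ 2 :> R by rewrite mulrn_wgt0 ?pi_gt0.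
have crr : cr_rect U V s 0 (ln r - s) (pi *+ 2).
  by move=> x y xx _; apply: dF; lra.
have := goursat _ (ltW pi2) crr; rewrite subr_ge0 => /(_ sr).
rewrite /rect_int subrKC !add0r.
have -> : (fun x => V x (pi *+ 2)) = (fun x => V x 0).
  apply/funext => x; rewrite /V /F /cexp/=.
  by rewrite -[pi *+ 2]add0r cosD2pi sinD2pi.
rewrite subrr addr0 => /eqP; rewrite subr_eq0 => /eqP E.
have cU x y : x <= ln r -> {for y, continuous (U x)}.
  by move=> xr; have [] := cauchy_riemann_continuous (dF x y xr).
have U1 : seg_int 0 (pi *+ 2) (U (ln r)) <= (Re (f z0) - eta) * (pi *+ 2 - 0).
  rewrite -seg_int_cst ?(ltW pi2)//; apply: seg_int_le.
  - by move=> y _; apply: cU.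
  - by move=> y _; apply: cst_continuous.
  - by move=> y _; apply: fr; rewrite absF lnK.
have U2 : (Re (f z0) - eta / 2) * (pi *+ 2 - 0) <= seg_int 0 (pi *+ 2) (U s).
  rewrite -seg_int_cst ?(ltW pi2)//; apply: seg_int_le.
  - by move=> y _; apply: cst_continuous.
  - by move=> y _; apply: cU.
  - move=> y _; have := Hd (z0 + cexp (s +i* y)); rewrite absF => /(_ sd).
    have := normRe_le (F (s +i* y) - f z0); rewrite -/(F (s +i* y)) /U.
    rewrite (_ : Re (F (s +i* y) - f z0) = Re (F (s +i* y)) - Re (f z0)); last first.
      by case: (F _) => ? ?; case: (f z0).
    by rewrite ler_norml; lra.
rewrite E in U1; have := le_trans U2 U1; rewrite ler_pM2r; lra.
Qed.

(** Closedness is expressed through [cabs] and compactness in the real plane, where the extreme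
    value theorem will be applied. *)
Lemma compact_complex_set (A : set R[i]) : A `<=` unit_disc (R := R) ->
  (forall z, ~ A z -> exists2 d : R, 0 < d & forall w, cabs (w - z) < d -> ~ A w) ->
  compact [set p : R * R | A (p.1 +i* p.2)].
Proof.
move=> AD Acl.
have cQ : compact (`[-1, 1]%classic `*` `[-1, 1]%classic : set (R * R)).
  by apply: compact_setX; exact: segment_compact.
apply: (subclosed_compact _ cQ); last first.
  move=> [x y] /= /AD; rewrite /unit_disc/= => xy.
  have := normRe_le (x +i* y); have := normIm_le (x +i* y); rewrite !ler_norml /=.
  by rewrite !in_itv/=; split; lra.
rewrite -openC openE => -[x y] /= /Acl[d d0 H]; rewrite /interior.
apply/nbhs_ballP; exists (d / 2); rewrite /= ?divr_gt0// => -[x' y'] [/= bx b_y].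
apply: H; apply: le_lt_trans (cabs_le _) _ => /=.
by move: bx b_y; rewrite /ball/= ![`|x - _|]distrC ![`|y - _|]distrC; lra.
Qed.

(** Maximize [|g| + e |z| ^ 2] over [A]. The added term is strictly subharmonic, so an interior
    maximum with a full neighbourhood in [A] contradicts [circle_mean_le] at once, without any
    propagation along a connected set. The maximum is thus at a point where [|g| <= B], and [e]
    tends to 0. *)
Lemma max_modulus g (A : set R[i]) (B : R) : holomorphic_on_disc g ->
  A `<=` unit_disc (R := R) ->
  (forall z, ~ A z -> exists2 d : R, 0 < d & forall w, cabs (w - z) < d -> ~ A w) ->
  (forall z, A z -> cabs (g z) <= B \/
     exists2 d : R, 0 < d & forall w, cabs (w - z) < d -> A w) ->
  forall z, A z -> cabs (g z) <= B.
Proof.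
move=> /holomorphic_cdiff dg AD Acl Abd z Az; apply/ler_addgt0Pr => e e0.
pose Phi (p : R * R) := cabs (g (p.1 +i* p.2)) + e * (p.1 * p.1 + p.2 * p.2).
pose A2 := [set p : R * R | A (p.1 +i* p.2)].
have A20 : A2 !=set0 by exists (Re z, Im z); rewrite /A2/=; case: (z) Az.
have cPhi : {within A2, continuous Phi}.
  apply: continuous_in_subspaceT => p; rewrite inE => Ap.
  apply: (@continuousD _ _ _ (fun p : R * R => cabs (g (p.1 +i* p.2)))
    (fun p => e * (p.1 * p.1 + p.2 * p.2))).
  + apply/cvgrPdist_lt => e' e'0.
    have [d d0 H] := cdiff_near_cabs (dg _ (AD _ Ap)) e'0.
    have d20 : 0 < d / 2 by rewrite divr_gt0.
    apply: filterS (nbhsx_ballx p (d / 2) d20) => -[x' y'] [/= bx b_y].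
    have {}H : cabs (g (x' +i* y') - g (p.1 +i* p.2)) < e'.
      apply: H; apply: le_lt_trans (cabs_le _) _ => /=.
      by move: bx b_y; rewrite /ball/= ![`|p.1 - _|]distrC ![`|p.2 - _|]distrC; lra.
    have := cabs_leBD (g (x' +i* y')) (g (p.1 +i* p.2)).
    have := cabs_leBD (g (p.1 +i* p.2)) (g (x' +i* y')).
    by rewrite [cabs (g (p.1 +i* p.2) - _)]cabsB ltr_norml; lra.
  + apply: (@continuousM _ _ (fun=> e) (fun p : R * R => p.1 * p.1 + p.2 * p.2)).
      exact: cst_continuous.
    apply: (@continuousD _ _ _ (fun p : R * R => p.1 * p.1) (fun p => p.2 * p.2)).
      by apply: continuousM; exact: cvg_fst.
    by apply: continuousM; exact: cvg_snd.
have [p] := compact_EVT_max A20 (compact_complex_set AD Acl) cPhi.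
rewrite inE => Ap max.
have [z0 z0E] : exists z0 : R[i], z0 = p.1 +i* p.2 by eexists.
have Az0 : A z0 by rewrite z0E.
have Phi_z w : Phi (Re w, Im w) = cabs (g w) + e * cabs w ^+ 2.
  by rewrite /Phi sqr_cabs !expr2 /=; case: (w).
have Phi_z0 : Phi p = cabs (g z0) + e * cabs z0 ^+ 2 by rewrite z0E /Phi sqr_cabs !expr2.
have maxz w : A w -> cabs (g w) + e * cabs w ^+ 2 <= cabs (g z0) + e * cabs z0 ^+ 2.
  move=> Aw; rewrite -Phi_z -Phi_z0; apply: max; rewrite inE /A2/=.
  by case: (w) Aw.
have z01 : cabs z0 < 1 by exact: AD.
have [gB|[d d0 H]] := Abd _ Az0.
  have := maxz _ Az;
  have := mulr_ge0 (ltW e0) (sqr_ge0 (cabs z)).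
  have : e * cabs z0 ^+ 2 <= e * 1.
    by rewrite ler_pM2l// exprn_ile1 ?cabs_ge0 ?(ltW z01).
  by lra.
exfalso.
(* A unimodular factor makes [c * g z0] equal to its modulus, so that [Re (c * g w)] can be compared
   with [|g w|]; when [g z0 = 0], [c = 1] serves. *)
have [c [c1 cg]] : exists c : R[i], cabs c = 1 /\ c * g z0 = (cabs (g z0))%:C.
  have [->|gz0] := eqVneq (g z0) 0; first by exists 1; rewrite cabs1 mulr0 cabs0.
  exists ((cabs (g z0))%:C / g z0); rewrite divfK// cabsM cabsV cabs_real.
  by rewrite ger0_norm ?cabs_ge0// divff// cabs_eq0.
(* The real part of the linear term is the linearization of [e |w| ^ 2] at [z0], up to a constant:
   [|w| ^ 2 - |z0| ^ 2 = 2 Re (conj z0 * (w - z0)) + |w - z0| ^ 2]. Maximality then makes [Re f]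
   drop by at least [e (d / 2) ^ 2] on the circle of radius [d / 2]. *)
pose f w := c * g w + (2 * e)%:C * z0^*%C * w.
have ref w : Re (f w) = Re (c * g w) + 2 * e * (Re z0 * Re w + Im z0 * Im w).
  by rewrite /f; case: (c * g w) => ? ?; case: (w) => ? ?; case: (z0) => ? ? /=; ring.
have r0 : 0 < d / 2 by rewrite divr_gt0.
apply: (@circle_mean_le f z0 (d / 2) (e * (d / 2) ^+ 2)) => //.
- by rewrite mulr_gt0// exprn_gt0.
- move=> w wr; have Aw : A w by apply: H; lra.
  exact (cdiffD (cdiffM (cdiff_cst c w) (dg _ (AD _ Aw)))
    (cdiffM (cdiff_cst ((2 * e)%:C * z0^*%C) w) (cdiff_id w))).
- move=> w wr; have Aw : A w by apply: H; lra.
  have := maxz _ Aw; rewrite !ref cg /=; have := Re_le (c * g w); rewrite cabsM c1 mul1r.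
  have : cabs (w - z0) ^+ 2 = (d / 2) ^+ 2 by rewrite wr.
  rewrite !sqr_cabs (_ : Re (w - z0) = Re w - Re z0); last by case: (w) => ? ?; case: (z0).
  rewrite (_ : Im (w - z0) = Im w - Im z0); last by case: (w) => ? ?; case: (z0).
  move: (Re (c * g w)) (cabs (g w)) (cabs (g z0)) (Re w) (Im w) (Re z0) (Im z0).
  by move: ((d / 2) ^+ 2) => D t G G0 a b a0 b0 <- /=; lra.
Qed.

End MaximumModulus.

(** * Dividing out finitely many zeros *)

Section Factorization.
Variable R : realType.
Implicit Types (f g h : R[i] -> R[i]) (z w a : R[i]).

(* At [a] the cofactor is the quotient of [h], which the definition of the
   multiplicity provides, by the other factors; no removable singularity theorem
   is needed. *)
Lemma holomorphic_factor f (A : seq R[i]) (m : R[i] -> nat) :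
  holomorphic_on_disc f -> uniq A -> (forall a, a \in A -> cabs a < 1) ->
  (forall a, a \in A -> exists2 g, holomorphic_on_disc g &
     forall z, unit_disc z -> f z = (z - a) ^+ m a * g z) ->
  exists2 g, holomorphic_on_disc g & forall z, unit_disc z ->
    f z = \prod_(a <- A) (z - a) ^+ m a * g z.
Proof.
move=> df; elim: A => [|a A IH] /=.
  by move=> _ _ _; exists f => // z _; rewrite big_nil mul1r.
move=> /andP[aA uA] A1 Am.
have [|||g /holomorphic_cdiff dg fg] := IH; first exact: uA.
- by move=> b bA; apply: A1; rewrite in_cons bA orbT.
- by move=> b bA; apply: Am; rewrite in_cons bA orbT.
have [h /holomorphic_cdiff dh fh] := Am a (mem_head _ _).
have a1 : cabs a < 1 by apply: A1; exact: mem_head.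
pose P z := \prod_(b <- A) (z - b) ^+ m b.
have dP z : cdiff P z.
  apply: cdiff_prod => b; apply: cdiffX; apply: cdiffB; [exact: cdiff_id|exact: cdiff_cst].
have Pa : P a != 0.
  rewrite /P prodf_seq_neq0; apply/allP => b bA /=.
  by rewrite expf_neq0// subr_eq0; apply: contraNneq aA => ->.
exists (fun z => if z == a then h a / P a else g z / (z - a) ^+ m a).
- apply/holomorphic_cdiff => z z1; have [->|za] := eqVneq z a.
    (* While [P w] is closer to [P a] than [|P a|], it cannot vanish. So [h / P] makes sense around
       [a] and agrees there with [g / (z - a) ^ m a] off [a]. *)
    have [d d0 Hd] := cdiff_near_cabs (dP a) (e := cabs (P a)) ltac:(by rewrite cabs_gt0).
    have d10 : 0 < Num.min d (1 - cabs a) by rewrite lt_min d0 subr_gt0.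
    apply: (@cdiff_near _ _ (fun w => h w * (P w)^-1) a _ d10); last first.
      by apply: cdiffM; [exact: dh|exact: cdiffV].
    move=> w; rewrite lt_min => /andP[/Hd Pw wd].
    have [->//|wa] := eqVneq w a.
    have w1 : unit_disc w by rewrite /unit_disc/=; have := cabs_leBD w a; lra.
    have Pw0 : P w != 0.
      by apply: contraTneq Pw => ->; rewrite sub0r cabsN ltxx.
    have wam : (w - a) ^+ m a != 0 by rewrite expf_neq0// subr_eq0.
    apply: (mulfI wam); apply: (mulfI Pw0).
    have := fh w w1; rewrite (fg w w1) -/(P w) => E.
    have -> : P w * ((w - a) ^+ m a * (g w / (w - a) ^+ m a)) = P w * g w by field.
    by rewrite E; field.
  apply: (@cdiff_near _ _ (fun w => g w * ((w - a) ^+ m a)^-1) z (cabs (z - a))).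
  + by rewrite cabs_gt0 subr_eq0.
  + move=> w wz; case: eqVneq => // wa; move: wz.
    by rewrite wa cabsB ltxx.
  + apply: cdiffM; first exact: dg.
    apply: (@cdiffV _ (fun w => (w - a) ^+ m a)).
      by rewrite expf_neq0// subr_eq0.
    apply: (@cdiffX _ (fun w => w - a)); apply: cdiffB; [exact: cdiff_id|exact: cdiff_cst].
- move=> z z1; rewrite big_cons -/(P z); have [->|za] := eqVneq z a.
    by rewrite (fh a a1); field.
  have zam : (z - a) ^+ m a != 0 by rewrite expf_neq0// subr_eq0.
  by rewrite (fg z z1) -/(P z); field.
Qed.

End Factorization.

(** * Poisson kernels and Blaschke factors *)

Section Kernels.
Variable R : realType.
Implicit Types (z w a u : R[i]).

(** The real part is the Poisson kernel, positive for [|u| < 1], and the value at 0 is 1: a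
    combination of such kernels takes at the origin the sum of its coefficients. *)
Definition cayley u : R[i] := (1 + u) / (1 - u).

Lemma Re_cayley u : u != 1 ->
  Re (cayley u) = (1 - cabs u ^+ 2) / cabs (1 - u) ^+ 2.
Proof.
move=> u1; have : cabs (1 - u) ^+ 2 != 0.
  by rewrite expf_neq0// cabs_eq0 subr_eq0 eq_sym.
rewrite !sqr_cabs; case: u {u1} => a b /=; rewrite !add0r => H; field.
by apply: contra_neq H => H; rewrite -[RHS]H; ring.
Qed.

Lemma cabs_lt1_neq1 u : cabs u < 1 -> u != 1.
Proof. by apply: contraTneq => ->; rewrite cabs1 ltxx. Qed.

Lemma Re_cayley_ge0 u : cabs u < 1 -> 0 <= Re (cayley u).
Proof.
move=> u1; rewrite Re_cayley ?cabs_lt1_neq1// divr_ge0 ?sqr_ge0// subr_ge0.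
by rewrite exprn_ile1 ?cabs_ge0// ltW.
Qed.

Lemma sqr_cabs_blaschke a z : cabs (1 - a^*%C * z) ^+ 2 =
  cabs (z - a) ^+ 2 + (1 - cabs a ^+ 2) * (1 - cabs z ^+ 2).
Proof. by rewrite !sqr_cabs; case: a => a b; case: z => x y /=; ring. Qed.

(** Squared, this is [1 + X <= expR X] inserted in the identity [sqr_cabs_blaschke]; the square
    accounts for the last division by 2. *)
Lemma blaschke_le_exp a z : z != a ->
  cabs (1 - a^*%C * z) <= cabs (z - a) *
    expR ((1 - cabs a ^+ 2) * (1 - cabs z ^+ 2) / cabs (z - a) ^+ 2 / 2).
Proof.
move=> za; set X := _ / cabs (z - a) ^+ 2.
have az0 : 0 < cabs (z - a) by rewrite cabs_gt0 subr_eq0.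
rewrite -ler_sqr ?nnegrE ?cabs_ge0 ?mulr_ge0 ?cabs_ge0 ?expR_ge0//.
rewrite exprMn -expRM_natl sqr_cabs_blaschke.
have -> : 2 * (X / 2) = X by field.
have -> : (1 - cabs a ^+ 2) * (1 - cabs z ^+ 2) = cabs (z - a) ^+ 2 * X.
  by rewrite /X [RHS]mulrC divfK// expf_neq0// gt_eqF.
rewrite -[X in X + _]mulr1 -mulrDr ler_pM2l ?exprn_gt0//.
exact: expR_ge1Dx.
Qed.

End Kernels.

(** * The distance to a subset of the circle *)

Section DistanceToSet.
Variables (R : realType) (E : set R[i]).
Hypotheses (E_circle : E `<=` unit_circle (R := R)) (E_nonempty : E !=set0).
Implicit Types (z w : R[i]).

Lemma dist_to_has_inf z : has_inf [set cabs (z - w) | w in E].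
Proof.
have [w Ew] := E_nonempty.
by split; [exists (cabs (z - w)), w|exists 0 => _ [v _ <-]; exact: cabs_ge0].
Qed.

Lemma dist_to_le z w : E w -> dist_to z E <= cabs (z - w).
Proof. by move=> Ew; apply: (ge_inf (dist_to_has_inf z).2); exists w. Qed.

Lemma le_dist_to z x : (forall w, E w -> x <= cabs (z - w)) -> x <= dist_to z E.
Proof.
by move=> H; apply: lb_le_inf; [exact: (dist_to_has_inf z).1|move=> _ [w Ew <-]; exact: H].
Qed.

Lemma dist_to_lip z w : dist_to z E <= dist_to w E + cabs (z - w).
Proof.
rewrite -lerBlDr; apply: le_dist_to => v Ev; rewrite lerBlDr.
apply: le_trans (dist_to_le z Ev) _; rewrite [leRHS]addrC; exact: cabs_triangle.
Qed.

Lemma dist_to_ge z : 1 - cabs z <= dist_to z E.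
Proof.
apply: le_dist_to => w /E_circle; rewrite /unit_circle/= => w1.
by have := cabs_leBD w z; rewrite cabsB w1; lra.
Qed.

Lemma dist_to_leD z : dist_to z E <= cabs z + 1.
Proof.
have [w Ew] := E_nonempty; apply: le_trans (dist_to_le z Ew) _.
by have := cabsD z (- w); rewrite cabsN (E_circle Ew).
Qed.

End DistanceToSet.

(** * Angles and equally spaced points on the circle *)

Section Circle.
Variable R : realType.
Implicit Types (x y : R).

Definition circ x : R[i] := cos x +i* sin x.

Lemma cabs_circ x : cabs (circ x) = 1.
Proof. by apply/eqP; rewrite -(eqrXn2 (n := 2)) ?cabs_ge0// sqr_cabs/= cos2Dsin2 expr1n. Qed.

Lemma dist_cos_le x y : `|cos x - cos y| <= `|x - y|.
Proof.
wlog : x y / x <= y.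
  move=> H; have [/H//|/ltW/H] := leP x y.
  by rewrite distrC [X in _ <= X]distrC.
move=> xy.
have [c _] := @MVT_segment R cos (fun x => - sin x) x y xy
  (fun x _ => is_derive_cos x) (continuous_subspaceT (@continuous_cos R)).
move=> E; rewrite distrC E normrM distrC ler_piMl// normrN ler_norml.
by rewrite sin_geN1 sin_le1.
Qed.

Lemma dist_sin_le x y : `|sin x - sin y| <= `|x - y|.
Proof.
wlog : x y / x <= y.
  move=> H; have [/H//|/ltW/H] := leP x y.
  by rewrite distrC [X in _ <= X]distrC.
move=> xy.
have [c _] := @MVT_segment R sin cos x y xy
  (fun x _ => is_derive_sin x) (continuous_subspaceT (@continuous_sin R)).
move=> E; rewrite distrC E normrM distrC ler_piMl// ler_norml.
by rewrite cos_geN1 cos_le1.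
Qed.

Lemma dist_circ_le x y : cabs (circ x - circ y) <= 2 * `|x - y|.
Proof.
apply: le_trans (cabs_le _) _.
by have := dist_cos_le x y; have := dist_sin_le x y; rewrite /=; lra.
Qed.

Lemma circ_polar (z : R[i]) : z != 0 ->
  exists2 x, 0 <= x < pi *+ 2 & z = (cabs z)%:C * circ x.
Proof.
move=> z0; have r0 : 0 < cabs z by rewrite cabs_gt0.
pose c := Re z / cabs z.
have c2 : c ^+ 2 + (Im z / cabs z) ^+ 2 = 1.
  by rewrite !expr_div_n -mulrDl -sqr_cabs divff// expf_neq0// gt_eqF.
have c1 : -1 <= c <= 1.
  rewrite -ler_norml -(ler_pXn2r (n := 2)) ?nnegrE// expr1n real_normK ?num_real//.
  by have := sqr_ge0 (Im z / cabs z); lra.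
have [ac ca] := acos_def c1.
have sa : sin (acos c) = `|Im z| / cabs z.
  rewrite sin_acos// (_ : 1 - c ^+ 2 = (`|Im z| / cabs z) ^+ 2); last first.
    by move: c2; rewrite !expr_div_n real_normK ?num_real//; lra.
  by rewrite sqrtr_sqr ger0_norm// divr_ge0// ltW.
have zE x : cos x = c -> sin x = Im z / cabs z -> z = (cabs z)%:C * circ x.
  move=> cx sx; rewrite /circ cx sx /c.
  have r0' : cabs z != 0 by rewrite gt_eqF.
  move: r0'; case: (z) => a b; set r := cabs _ => r0'.
  by apply/eqP; rewrite eq_complex/=; apply/andP; split; apply/eqP; field.
have pi0 := pi_gt0 R.
have [Im0|Im0] := leP 0 (Im z).
  exists (acos c); first by rewrite mulr2n; lra.
  by apply: zE => //; rewrite sa ger0_norm.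
exists (pi *+ 2 - acos c).
  (* The angle has to stay strictly below [2 pi]. If [acos c] were 0, [sa] would give [Im z = 0],
     against [Im z < 0]. *)
  suff H : acos c != 0.
    have : 0 < acos c by rewrite lt_def H; case/andP: ac.
    by rewrite mulr2n; lra.
  by apply: contraTneq Im0 => a0; rewrite -leNgt; move: sa; rewrite a0 sin0;
    move=> /esym/eqP; rewrite mulf_eq0 invr_eq0 (gt_eqF r0) orbF normr_eq0 => /eqP->.
apply: zE.
- by rewrite addrC cosD2pi cosN.
- by rewrite addrC sinD2pi sinN sa ltr0_norm// mulNr opprK.
Qed.

(** Move radially to the circle, over a distance [1 - |z|], then along it back to the preceding
    multiple of [2 pi / N]; the factor 2 is that of [dist_circ_le]. *)
Lemma nearest_circ (z : R[i]) N : z != 0 -> cabs z <= 1 -> (0 < N)%N ->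
  exists k : 'I_N, cabs (z - circ (pi *+ 2 * k%:R / N%:R)) <=
    1 - cabs z + 2 * (pi *+ 2 / N%:R).
Proof.
move=> z0 z1 N0; have [x /andP[x0 xpi] zE] := circ_polar z0.
have pi2 : 0 < pi *+ 2 :> R by rewrite mulrn_wgt0 ?pi_gt0.
have NR : 0 < N%:R :> R by rewrite ltr0n.
pose y := x * N%:R / (pi *+ 2).
have y0 : 0 <= y by rewrite divr_ge0 ?mulr_ge0// ltW.
have /andP[k1 k2] := truncn_itv y0.
have kN : (Num.truncn y < N)%N.
  rewrite -(ltr_nat R); apply: le_lt_trans k1 _.
  by rewrite ltr_pdivrMr// mulrC ltr_pM2l.
exists (Ordinal kN) => /=; set k := Num.truncn y.
apply: le_trans (cabs_triangle _ (circ x) _) _; apply: lerD.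
  have -> : z - circ x = ((cabs z) - 1)%:C * circ x.
    by rewrite {1}zE rmorphB/= mulrBl mul1r.
  by rewrite cabsM cabs_circ mulr1 cabs_real distrC ger0_norm// subr_ge0.
apply: le_trans (dist_circ_le _ _) _; rewrite ler_pM2l//.
have xE : x = pi *+ 2 * y / N%:R.
  by rewrite /y [_ * (_ / _)]mulrC divfK ?mulfK// gt_eqF.
rewrite [X in `|X - _|]xE -mulrBl -mulrBr normrM normrM.
rewrite (gtr0_norm pi2) (@gtr0_norm _ N%:R^-1) ?invr_gt0//.
rewrite ler_pM2r ?invr_gt0// ler_piMr ?(ltW pi2)//.
by rewrite ler_norml; move: k1 k2; rewrite -/k -natr1; lra.
Qed.

End Circle.

(** * Lower bounds for kernels with poles outside the disc *)

Section CayleyKernel.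
Variable R : realType.
Implicit Types (a z u : R[i]) (t x : R).

Lemma cayley0 : cayley 0 = 1 :> R[i].
Proof. by rewrite /cayley addr0 subr0 divr1. Qed.

Lemma cdiff_cayley (b : R[i]) z : cabs (b * z) < 1 -> cdiff (fun z => cayley (b * z)) z.
Proof.
move=> bz; have db : cdiff (fun z => b * z) z by apply: cdiffM; [exact: cdiff_cst|exact: cdiff_id].
apply: cdiffM; first by apply: cdiffD => //; exact: cdiff_cst.
apply: (@cdiffV _ (fun z => 1 - b * z)); last by apply: cdiffB => //; exact: cdiff_cst.
by rewrite subr_eq0 eq_sym cabs_lt1_neq1.
Qed.

Lemma Re_realM x z : Re (x%:C * z) = x * Re z.
Proof. by case: z => a b /=; rewrite mul0r subr0. Qed.

Lemma Re_sum (I : Type) (s : seq I) (P : pred I) (F : I -> R[i]) :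
  Re (\sum_(i <- s | P i) F i) = \sum_(i <- s | P i) Re (F i).
Proof. by apply: (big_morph (@complex.Re R)) => // -[a b] [c d]. Qed.

(* The pole of the kernel lies at distance at least about [x] outside the disc. *)
Lemma Re_cayley_ge a z x y : 0 < x -> x <= 1 -> 0 < y -> cabs a <= 1 -> cabs z < 1 ->
  cabs (1 - a^*%C * z) + x <= y ->
  x / y ^+ 2 <= Re (cayley ((1 - x)%:C * a^*%C * z)).
Proof.
move=> x0 x1 y0 a1 z1 H; set u := _ * z.
have aa0 := cabs_ge0 a; have z0 := cabs_ge0 z.
have az : cabs a * cabs z < 1 by nra.
have cu : cabs u = (1 - x) * (cabs a * cabs z).
  by rewrite /u !cabsM cabs_conj cabs_real ger0_norm ?subr_ge0// mulrA.
have az0 : 0 <= cabs a * cabs z by rewrite mulr_ge0.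
have u1 : cabs u <= 1 - x by rewrite cu ler_piMr ?subr_ge0// ltW.
have u1' : cabs u < 1 by lra.
rewrite Re_cayley ?cabs_lt1_neq1//.
have un0 : 0 < cabs (1 - u) by rewrite cabs_gt0 subr_eq0 eq_sym cabs_lt1_neq1.
have uy : cabs (1 - u) <= y.
  have -> : 1 - u = (1 - a^*%C * z) + x%:C * (a^*%C * z).
    by rewrite /u rmorphB/=; ring.
  apply: le_trans (cabsD _ _) _; rewrite !cabsM cabs_conj cabs_real gtr0_norm//.
  have : x * (cabs a * cabs z) <= x by rewrite ler_piMr// ltW.
  by lra.
apply: ler_pM.
- exact: ltW.
- by rewrite invr_ge0 exprn_ge0// ltW.
- have := cabs_ge0 u; nra.
- by rewrite lef_pV2 ?posrE ?exprn_gt0// ler_pXn2r ?nnegrE// ltW.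
Qed.

(** With [D = |z - a|] the hypotheses give [31 t <= D], [1 - |z| ^ 2 <= t] and
    [|1 - conj a * z| <= 2 D]. Then [Re_cayley_ge] with [x = 32 t] and [y = 4 D] bounds the kernel
    below by [2 t / D ^ 2], so the weight [(1 - |a| ^ 2) / 4] is enough. This is half of the
    exponent in [norm_exp_le1]; the other half is the gain at the origin. *)
Lemma blaschke_correction (E : set R[i]) a z t :
  E `<=` unit_circle (R := R) -> E !=set0 ->
  0 < t -> 32 * t <= 1 -> cabs a < 1 -> cabs z < 1 ->
  32 * t <= dist_to a E -> dist_to z E <= t / 2 ->
  (1 - cabs a ^+ 2) * (1 - cabs z ^+ 2) / cabs (z - a) ^+ 2 / 2 <=
  (1 - cabs a ^+ 2) / 4 * Re (cayley ((1 - 32 * t)%:C * a^*%C * z)).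
Proof.
move=> EC E0 t0 t1 a1 z1 da dz.
set D := cabs (z - a).
have aa := cabs_ge0 a; have zz := cabs_ge0 z.
have DD : 31 * t <= D.
  by have := dist_to_lip E0 a z; rewrite [cabs (a - z)]cabsB -/D; lra.
have sz := dist_to_ge EC E0 z.
have z2 : 1 - cabs z ^+ 2 <= t by nra.
have z2' : 0 <= 1 - cabs z ^+ 2 by nra.
have a2' : 0 <= 1 - cabs a ^+ 2 by nra.
have a2 : 1 - cabs a ^+ 2 <= 3 * D.
  have : 1 - cabs a <= D + (1 - cabs z) by have := cabs_leBD z a; rewrite -/D; lra.
  by nra.
have az : cabs (1 - a^*%C * z) <= 2 * D.
  rewrite -ler_sqr ?nnegrE ?cabs_ge0//; last lra.
  rewrite sqr_cabs_blaschke -/D.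
  have : (1 - cabs a ^+ 2) * (1 - cabs z ^+ 2) <= 3 * D * D by apply: ler_pM => //; lra.
  by lra.
have D0 : 0 < D by lra.
have : 32 * t / (4 * D) ^+ 2 <= Re (cayley ((1 - 32 * t)%:C * a^*%C * z)).
  by apply: Re_cayley_ge => //; lra.
move=> C; apply: (@le_trans _ _ ((1 - cabs a ^+ 2) / 4 * (32 * t / (4 * D) ^+ 2))); last first.
  by rewrite ler_wpM2l// divr_ge0.
have -> : (1 - cabs a ^+ 2) / 4 * (32 * t / (4 * D) ^+ 2) =
    (1 - cabs a ^+ 2) * t / D ^+ 2 / 2 by field; lra.
by rewrite ler_pM2r// ler_wpM2r ?invr_ge0 ?exprn_ge0// ?(ltW D0)// ler_wpM2l.
Qed.

(** Squared, this is [1 - u <= expR (- u)] for [u = 1 - |a| ^ 2]. It expresses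
    [ln (1 / |a|) >= (1 - |a| ^ 2) / 2] in a form that allows [a = 0]. *)
Lemma norm_exp_le1 a : cabs a < 1 -> cabs a * expR ((1 - cabs a ^+ 2) / 2) <= 1.
Proof.
move=> a1; have aa := cabs_ge0 a.
rewrite -ler_sqr ?nnegrE ?mulr_ge0 ?expR_ge0// exprMn expr1n -expRM_natl.
have -> : 2 * ((1 - cabs a ^+ 2) / 2) = 1 - cabs a ^+ 2 by field.
rewrite -(@ler_pM2r _ (expR (- (1 - cabs a ^+ 2)))) ?expR_gt0//.
by rewrite -mulrA -expRD subrr expR0 mulr1 mul1r; have := expR_ge1Dx (- (1 - cabs a ^+ 2)); lra.
Qed.

End CayleyKernel.

(** * The maximum principle estimate for finitely many zeros away from [E] *)

Section CoreEstimate.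
Variables (R : realType) (E : set R[i]).
Hypotheses (E_circle : E `<=` unit_circle (R := R)) (E_nonempty : E !=set0).
Implicit Types (a z : R[i]).

Definition root_pt N (k : 'I_N) : R[i] := circ (pi *+ 2 * k%:R / N%:R).

Definition weight (q t : R) z : R := (Num.max (dist_to z E) t) `^ (- q).

Definition mean_weight (q t : R) N := (\sum_(k < N) weight q t (root_pt k)) / N%:R.

Definition majorant (q t : R) N (c : R) z : R[i] :=
  \sum_(k < N) (c * weight q t (root_pt k) / N%:R)%:C *
     cayley ((1 - t)%:C * (root_pt k)^*%C * z).

Lemma kernel_lt1 x a z : 0 <= x <= 1 -> cabs a <= 1 -> cabs z < 1 ->
  cabs ((1 - x)%:C * a^*%C * z) < 1.
Proof.
move=> x01 a1 z1; rewrite !cabsM cabs_conj cabs_real ger0_norm; last lra.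
apply: le_lt_trans z1; rewrite ler_piMl ?cabs_ge0// mulr_ile1 ?cabs_ge0//; lra.
Qed.

Lemma cabs_root N (k : 'I_N) : cabs (root_pt k) <= 1.
Proof. by rewrite cabs_circ. Qed.

Lemma cdiff_majorant q t N c z : 0 <= t <= 1 -> cabs z < 1 -> cdiff (majorant q t N c) z.
Proof.
move=> t01 z1; apply: cdiff_sum => k; apply: cdiffM; first exact: cdiff_cst.
by apply: cdiff_cayley; apply: kernel_lt1 => //; exact: cabs_root.
Qed.

Lemma Re_majorant0 q t N c : Re (majorant q t N c 0) = c * mean_weight q t N.
Proof.
rewrite /majorant Re_sum /mean_weight mulrA mulr_sumr mulr_suml.
by apply: eq_bigr => k _; rewrite mulr0 cayley0 Re_realM /= mulr1.
Qed.

(** Only the root nearest to [z] is used, the other kernels being nonnegative. It lies within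
    [3 t / 2], as [N t = 16] makes the spacing term at most [t]. Its kernel is at least
    [t / (5 t / 2) ^ 2], and multiplying by [1 / N = t / 16] gives [1 / 100]. As
    [t <= 2 dist (z, E)], the truncated distance at the root is at most [4 dist (z, E)], whence
    [4 ^ q]. *)
Lemma majorant_ge q t N K z : 0 < q -> 0 < t -> t <= 1 -> 0 <= K -> N%:R * t = 16 ->
  cabs z < 1 -> 1 - cabs z <= t / 2 -> t / 2 <= dist_to z E ->
  K / dist_to z E `^ q <= Re (majorant q t N (100 * 4 `^ q * K) z).
Proof.
move=> q0 t0 t1 K0 Nt z1 zt dz.
have N0 : (0 < N)%N by case: N Nt => //; rewrite mul0r; lra.
have NR : 0 < N%:R :> R by rewrite ltr0n.
have z0 : z != 0 by rewrite -cabs_gt0; lra.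
have [k] := nearest_circ z0 (ltW z1) N0; rewrite -/(root_pt k) => zk.
have pi4 : pi < 4 :> R by have := pihalf_lt2 R; lra.
have chord : 2 * (pi *+ 2 / N%:R) <= t.
  rewrite mulrA ler_pdivrMr// [t * _]mulrC Nt mulr2n; lra.
have {}zk : cabs (z - root_pt k) <= 3 / 2 * t by lra.
have t01 : 0 <= t <= 1 by lra.
have w0 j : 0 <= 100 * 4 `^ q * K * weight q t (root_pt j) / N%:R :> R.
  by rewrite divr_ge0 ?(ltW NR)// !mulr_ge0 ?powR_ge0.
have := @Re_cayley_ge _ (root_pt k) z t (5 / 2 * t) t0 t1 ltac:(lra) (cabs_root k) z1.
have E1 : cabs (1 - (root_pt k)^*%C * z) = cabs (z - root_pt k).
  apply/eqP; rewrite -(eqrXn2 (n := 2)) ?cabs_ge0// sqr_cabs_blaschke cabs_circ.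
  by rewrite expr1n subrr mul0r addr0.
rewrite E1 => /(_ ltac:(lra)) Ck.
rewrite /majorant Re_sum (bigD1 k)// -[leLHS]addr0; apply: lerD; last first.
  apply: sumr_ge0 => j _; rewrite Re_realM mulr_ge0//.
  by apply: Re_cayley_ge0; apply: kernel_lt1 => //; exact: cabs_root.
rewrite Re_realM.
apply: (@le_trans _ _ (100 * 4 `^ q * K * weight q t (root_pt k) / N%:R *
    (t / (5 / 2 * t) ^+ 2))); last first.
  by rewrite ler_wpM2l.
have -> : N%:R^-1 = t / 16 :> R.
  by apply: (mulfI (lt0r_neq0 NR)); rewrite divff ?lt0r_neq0// mulrA Nt divff.
have -> : 100 * 4 `^ q * K * weight q t (root_pt k) * (t / 16) * (t / (5 / 2 * t) ^+ 2)
   = K * (4 `^ q * weight q t (root_pt k)) by field; lra.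
rewrite ler_wpM2l//.
have d0 : 0 < dist_to z E by lra.
have -> : (dist_to z E `^ q)^-1 = 4 `^ q * (4 * dist_to z E) `^ (- q).
  by rewrite powRN powRM// ?(ltW d0)// invfM mulrA divff ?mul1r// gt_eqF// powR_gt0.
rewrite ler_wpM2l ?powR_ge0// /weight !powRN.
have m0 : 0 < Num.max (dist_to (root_pt k) E) t by rewrite lt_max t0 orbT.
rewrite lef_pV2 ?posrE ?powR_gt0//; last lra.
rewrite ge0_ler_powR// ?nnegrE ?(ltW m0) ?(ltW q0)//; first lra.
rewrite ge_max; have := dist_to_lip E_nonempty (root_pt k) z.
rewrite cabsB; lra.
Qed.

Lemma seq_disc_gap (A : seq R[i]) : (forall a, a \in A -> cabs a < 1) ->
  exists2 mu : R, 0 < mu & forall a, a \in A -> cabs a <= 1 - 2 * mu.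
Proof.
elim: A => [|a A IH] H; first by exists 1.
have [|mu mu0 Hmu] := IH; first by move=> b bA; apply: H; rewrite in_cons bA orbT.
have a1 : cabs a < 1 by apply: H; exact: mem_head.
exists (Num.min mu ((1 - cabs a) / 2)); first by rewrite lt_min mu0; lra.
move=> b; rewrite in_cons => /predU1P[->|/Hmu H1].
  have : Num.min mu ((1 - cabs a) / 2) <= (1 - cabs a) / 2 by rewrite ge_min lexx orbT.
  by lra.
have : Num.min mu ((1 - cabs a) / 2) <= mu by rewrite ge_min lexx.
by lra.
Qed.

Lemma le_expR_logp (x : R) : 0 <= x -> x <= expR (logp x).
Proof.
rewrite le_eqVlt => /predU1P[<-|x0]; first exact: expR_ge0.
by rewrite -{1}(lnK x0) ler_expR /logp le_max lexx.
Qed.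

Lemma prod_expR (A : seq R[i]) (m : R[i] -> nat) (X : R[i] -> R) :
  \prod_(a <- A) expR (X a) ^+ m a = expR (\sum_(a <- A) (m a)%:R * X a).
Proof.
rewrite (big_morph _ (@expRD R) (@expR0 R)).
by apply: eq_bigr => a _; rewrite expRM_natl.
Qed.

Variables (q t K : R) (N : nat) (f : R[i] -> R[i]) (A : seq R[i]) (m : R[i] -> nat).
Hypotheses (q_gt0 : 0 < q) (t_gt0 : 0 < t) (t_le : 32 * t <= 1) (K_gt0 : 0 < K).
Hypotheses (Nt : N%:R * t = 16) (f_holo : holomorphic_on_disc f) (f0 : cabs (f 0) = 1).
Hypothesis f_le : forall z, unit_disc z -> logp (cabs (f z)) <= K / dist_to z E `^ q.
Hypotheses (A_uniq : uniq A) (A_zeros : forall a, a \in A -> zeros f a).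
Hypothesis A_dist : forall a, a \in A -> 32 * t <= dist_to a E.
Hypothesis A_mult : forall a, a \in A -> exists2 g, holomorphic_on_disc g &
  forall z, unit_disc z -> f z = (z - a) ^+ m a * g z.

Let A1 a : a \in A -> cabs a < 1. Proof. by case/A_zeros. Qed.

Let t32 : 0 <= 32 * t <= 1. Proof. by rewrite t_le mulr_ge0// ltW. Qed.

Definition correction z : R[i] :=
  \sum_(a <- A) ((m a)%:R * ((1 - cabs a ^+ 2) / 4))%:C *
     cayley ((1 - 32 * t)%:C * a^*%C * z).

Lemma Re_correction z : Re (correction z) = \sum_(a <- A) (m a)%:R *
  ((1 - cabs a ^+ 2) / 4 * Re (cayley ((1 - 32 * t)%:C * a^*%C * z))).
Proof.
by rewrite /correction Re_sum; apply: eq_bigr => a _; rewrite Re_realM -[LHS]mulrA.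
Qed.

Lemma cdiff_correction z : cabs z < 1 -> cdiff correction z.
Proof.
(* [cdiff_sum] asks for differentiability at every index, and outside [A] the kernel could have a
   pole at [z]; such indices are replaced by 0. *)
move=> z1; have -> : correction = fun z => \sum_(a <- [seq a <- A | true])
    ((m a)%:R * ((1 - cabs a ^+ 2) / 4))%:C *
    cayley ((1 - 32 * t)%:C * (if a \in A then a else 0)^*%C * z).
  by apply/funext => w; rewrite /correction big_filter !big_seq; apply: eq_bigr => a ->.
apply: cdiff_sum => a; apply: cdiffM; first exact: cdiff_cst.
apply: cdiff_cayley; apply: kernel_lt1 => //.
by case: ifP => [/A1/ltW//|_]; rewrite cabs0.
Qed.

Let blaschke_exp a z := (1 - cabs a ^+ 2) * (1 - cabs z ^+ 2) / cabs (z - a) ^+ 2 / 2.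

Lemma Re_correction_ge0 z : cabs z < 1 -> 0 <= Re (correction z).
Proof.
move=> z1; rewrite Re_correction big_seq; apply: sumr_ge0 => a aA.
rewrite mulr_ge0// mulr_ge0//.
  by rewrite divr_ge0// subr_ge0 exprn_ile1 ?cabs_ge0// ltW// A1.
by apply: Re_cayley_ge0; apply: kernel_lt1 => //; exact/ltW/A1.
Qed.

Lemma Re_correction_ge z : cabs z < 1 -> dist_to z E <= t / 2 ->
  \sum_(a <- A) (m a)%:R * blaschke_exp a z <= Re (correction z).
Proof.
move=> z1 dz; rewrite Re_correction big_seq [leRHS]big_seq; apply: ler_sum => a aA.
by rewrite ler_wpM2l//; apply: (blaschke_correction (E := E)) => //; [exact: A1|exact: A_dist].
Qed.

Lemma zero_sum_bound : \sum_(a <- A) (m a)%:R * (1 - cabs a ^+ 2) <=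
  4 * (K + 100 * 4 `^ q * K * mean_weight q t N).
Proof.
have t0 := t_gt0; have t1 := t_le; have K0 := K_gt0.
have [g g_holo fE] := holomorphic_factor f_holo A_uniq A1 A_mult.
have [mu mu0 Hmu] := seq_disc_gap A1.
pose M : R := \sum_(a <- A) (m a)%:R.
have M0 : 0 <= M by apply: sumr_ge0.
(* On the circle of radius [1 - del], the first bound makes [majorant_ge] applicable, the second
   keeps the zeros at distance at least [mu], and the third keeps the total Blaschke exponent below
   [K]. [M + 1] avoids a division by zero. *)
pose del := Num.min (t / 2) (Num.min mu (K * mu ^+ 2 / (M + 1))).
have del0 : 0 < del.
  by rewrite /del !lt_min divr_gt0//= mu0/= divr_gt0 ?mulr_gt0 ?exprn_gt0//; lra.
have delt : del <= t / 2 by rewrite /del ge_min lexx.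
have delmu : del <= mu by rewrite /del !ge_min lexx orbT.
have delK : del * (M + 1) <= K * mu ^+ 2.
  by rewrite -ler_pdivlMr; [rewrite /del !ge_min lexx !orbT|lra].
pose F z := correction z + majorant q t N (100 * 4 `^ q * K) z.
have ReF z : Re (F z) = Re (correction z) + Re (majorant q t N (100 * 4 `^ q * K) z).
  by rewrite /F; case: (correction z) => ? ?; case: (majorant _ _ _ _ _).
pose P z := \prod_(a <- A) (1 - a^*%C * z) ^+ m a.
(* The cofactor [g] stands for [f / prod_a (z - a) ^ m a], so [G] is holomorphic across the
   zeros. *)
pose G z := g z * P z * cexp (- F z).
have GE z : cabs (G z) =
    cabs (g z) * \prod_(a <- A) cabs (1 - a^*%C * z) ^+ m a * expR (- Re (F z)).
  rewrite /G !cabsM cabs_prod cabs_cexp; congr (_ * _ * expR _).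
    by apply: eq_bigr => a _; rewrite cabsX.
  by case: (F z).
have G_holo : holomorphic_on_disc G.
  apply/holomorphic_cdiff => z z1; apply: cdiffM; first apply: cdiffM.
  - by move/holomorphic_cdiff: g_holo; apply.
  - apply: cdiff_prod => a; apply: cdiffX; apply: cdiffB; first exact: cdiff_cst.
    by apply: cdiffM; [exact: cdiff_cst|exact: cdiff_id].
  - apply: (@cdiff_comp _ (fun z => - F z) (@cexp R)); last exact: cdiff_cexp.
    have -> : (fun z => - F z) = (fun z => 0 - F z) by apply/funext => w; rewrite sub0r.
    apply: cdiffB; first exact: cdiff_cst.
    by apply: cdiffD; [exact: cdiff_correction|apply: cdiff_majorant => //; lra].
pose Om := [set z | cabs z <= 1 - del /\ t / 2 <= dist_to z E].
(* Common to both pieces of the boundary: [majorant] absorbs the bound on [f], and [correction]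
   absorbs the Blaschke factors up to [expR K]. *)
have bdry z : Om z -> 1 - cabs z <= t / 2 -> (forall a, a \in A -> z != a) ->
    \sum_(a <- A) (m a)%:R * blaschke_exp a z <= K + Re (correction z) ->
    cabs (G z) <= expR K.
  move=> [z1 dz] zt zA S; have z1' : cabs z < 1 by lra.
  have fz : cabs (f z) <= expR (K / dist_to z E `^ q).
    by apply: le_trans (le_expR_logp (cabs_ge0 _)) _; rewrite ler_expR f_le.
  have gP : cabs (g z) * \prod_(a <- A) cabs (1 - a^*%C * z) ^+ m a <=
      cabs (f z) * expR (\sum_(a <- A) (m a)%:R * blaschke_exp a z).
    rewrite fE// cabsM cabs_prod -prod_expR mulrAC [leLHS]mulrC ler_wpM2r ?cabs_ge0//.
    rewrite -big_split/= big_seq [leRHS]big_seq; apply: ler_prod => a aA.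
    rewrite exprn_ge0 ?cabs_ge0//= cabsX -exprMn; apply: lerXn2r.
    + by rewrite nnegrE cabs_ge0.
    + by rewrite nnegrE mulr_ge0 ?cabs_ge0 ?expR_ge0.
    + by apply: blaschke_le_exp; exact: zA.
  rewrite GE; apply: le_trans (ler_wpM2r (expR_ge0 _) gP) _.
  apply: le_trans (ler_wpM2r (expR_ge0 _) (ler_wpM2r (expR_ge0 _) fz)) _.
  rewrite -!expRD ler_expR ReF.
  have := @majorant_ge q t N K z q_gt0 t_gt0 ltac:(lra) (ltW K_gt0) Nt z1' zt dz.
  by lra.
have GOm : forall z, Om z -> cabs (G z) <= expR K.
  apply: max_modulus => //.
  - by move=> z [z1 _]; rewrite /unit_disc/=; lra.
  - move=> z /not_andP[/negP|/negP]; rewrite -ltNge => H.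
      exists (cabs z - (1 - del)); first lra.
      by move=> w wz [w1 _]; have := cabs_leBD z w; rewrite cabsB; lra.
    exists (t / 2 - dist_to z E); first lra.
    by move=> w wz [_ dw]; have := dist_to_lip E_nonempty w z; lra.
  move=> z Oz; have [z1 dz] := Oz.
  have [zd|zd] := ltP (cabs z) (1 - del); last first.
    (* Outer circle: here the extra [K] in [bdry] pays for the Blaschke exponents, and
       [Re (correction z) >= 0] is enough. *)
    left; have zE : cabs z = 1 - del by lra.
    have zA a : a \in A -> mu <= cabs (z - a).
      by move=> /Hmu; have := cabs_leBD z a; lra.
    apply: bdry => //; first lra.
      by move=> a /zA H; rewrite -subr_eq0 -cabs_gt0; lra.
    apply: (@le_trans _ _ K); last by rewrite lerDl Re_correction_ge0//; lra.
    apply: (@le_trans _ _ (\sum_(a <- A) (m a)%:R * (del / mu ^+ 2))).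
      rewrite big_seq [leRHS]big_seq; apply: ler_sum => a aA; rewrite ler_wpM2l//.
      have a1 := A1 aA; have aa := cabs_ge0 a; have zz := cabs_ge0 z.
      have az := zA _ aA.
      rewrite /blaschke_exp ler_pdivrMr// [leRHS]mulrAC; apply: ler_pM.
      + by apply: mulr_ge0; nra.
      + by rewrite invr_ge0 exprn_ge0// cabs_ge0.
      + rewrite zE -[leRHS]mul1r mulrC [leRHS]mulrC; apply: ler_pM; nra.
      + rewrite lef_pV2 ?posrE ?exprn_gt0//; last lra.
        by rewrite ler_pXn2r ?nnegrE ?cabs_ge0// ltW.
    rewrite -mulr_suml -/M mulrA ler_pdivrMr ?exprn_gt0//; nra.
  have [dt|dt] := ltP (t / 2) (dist_to z E); last first.
    (* Inner boundary, at distance [t / 2] from [E]: here [Re_correction_ge] pays for the exponents,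
       and the zeros are too far from [E] to lie on it. *)
    left; have zt := dist_to_ge E_circle E_nonempty z.
    apply: bdry => //; first lra.
      move=> a /A_dist da; apply: contraTneq dt => ->; rewrite -ltNge; lra.
    by apply: (le_trans (Re_correction_ge _ _)) => //; lra.
  right; exists (Num.min (1 - del - cabs z) (dist_to z E - t / 2)).
    by rewrite lt_min; lra.
  move=> w; rewrite lt_min => /andP[w1 w2]; split.
    by have := cabs_leBD w z; lra.
  by have := dist_to_lip E_nonempty z w; rewrite cabsB; lra.
have O0 : Om 0.
  by split; [rewrite cabs0; lra|have := dist_to_ge E_circle E_nonempty 0; rewrite cabs0; lra].
have := GOm _ O0; rewrite GE.
have -> : \prod_(a <- A) cabs (1 - a^*%C * 0) ^+ m a = 1.
  by apply: big1 => a _; rewrite mulr0 subr0 cabs1 expr1n.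
rewrite mulr1.
(* [|f 0| = 1] gives [|g 0| = 1 / prod_a |a| ^ m a], and each factor is estimated by
   [norm_exp_le1]. *)
have g0 : expR (\sum_(a <- A) (m a)%:R * ((1 - cabs a ^+ 2) / 2)) <= cabs (g 0).
  have D0 : cabs (0 : R[i]) < 1 by rewrite cabs0.
  have := f0; rewrite fE; last exact: D0.
  rewrite cabsM cabs_prod => f01.
  have Pf0 : 0 <= \prod_(a <- A) cabs ((0 - a) ^+ m a).
    by apply: prodr_ge0 => a _; exact: cabs_ge0.
  have Pf1 : 0 < \prod_(a <- A) cabs ((0 - a) ^+ m a).
    by rewrite lt_def Pf0 andbT; apply: contra_eq_neq f01 => ->; rewrite mul0r eq_sym oner_eq0.
  rewrite -(ler_pM2l Pf1) f01 -prod_expR -big_split/=.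
  apply: (@le_trans _ _ (\prod_(a <- A) 1)); last by rewrite big1.
  rewrite big_seq [leRHS]big_seq; apply: ler_prod => a aA.
  rewrite mulr_ge0 ?cabs_ge0 ?exprn_ge0 ?expR_ge0//= sub0r cabsX cabsN -exprMn.
  rewrite exprn_ile1 ?mulr_ge0 ?cabs_ge0 ?expR_ge0//.
  exact/norm_exp_le1/A1.
(* In logarithms, with [S] the sum to be bounded: [S / 2 <= K + S / 4 + 100 * 4 ^ q * K *
   mean_weight], whence the factor 4. *)
move=> H; have := le_trans (ler_wpM2r (expR_ge0 _) g0) H.
rewrite -expRD ler_expR ReF Re_majorant0 Re_correction.
have -> : \sum_(a <- A) (m a)%:R * ((1 - cabs a ^+ 2) / 2) =
    (\sum_(a <- A) (m a)%:R * (1 - cabs a ^+ 2)) / 2.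
  by rewrite mulr_suml; apply: eq_bigr => a _; rewrite mulrA.
have -> : \sum_(a <- A) (m a)%:R *
  ((1 - cabs a ^+ 2) / 4 * Re (cayley ((1 - 32 * t)%:C * a^*%C * 0))) =
    (\sum_(a <- A) (m a)%:R * (1 - cabs a ^+ 2)) / 4.
  by rewrite mulr_suml; apply: eq_bigr => a _; rewrite mulr0 cayley0 /= mulr1 mulrA.
lra.
Qed.

End CoreEstimate.

(** * Measure of the neighbourhoods of [E] on the circle *)

Section CircleNeighbourhoods.
Variables (R : realType) (E : set R[i]).
Hypotheses (E_circle : E `<=` unit_circle (R := R)) (E_nonempty : E !=set0).
Notation mu := (@lebesgue_measure R).
Implicit Types x y : R.

(** Spelled as in [ahern_clark_type], so that the growth condition there is by conversion a
    condition on [nbh_size]. *)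
Definition nbh x : set R[i] := [set z | unit_circle z /\ dist_to z E < x].

Definition nbh_size x : R := fine (circle_measure (nbh x)).

Definition nbh_arg x : set R := [set s : R | 0 <= s < pi *+ 2 /\ nbh x (circ s)].

Lemma nbh_argE x : nbh_arg x = `[0, pi *+ 2[ `&` [set s | dist_to (circ s) E < x].
Proof.
apply/seteqP; split=> s /=; rewrite in_itv/=; first by case=> ? [].
by move=> [s0 sx]; split => //; split => //; exact: cabs_circ.
Qed.

Lemma continuous_dist_circ : continuous (fun s : R => dist_to (circ s) E).
Proof.
move=> s; apply/cvgrPdist_lt => e e0.
have e20 : 0 < e / 2 by rewrite divr_gt0.
apply: filterS (nbhsx_ballx s (e / 2) e20) => s'; rewrite /ball/= => ss.
have := dist_to_lip E_nonempty (circ s) (circ s').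
have := dist_to_lip E_nonempty (circ s') (circ s).
rewrite [cabs (circ s' - _)]cabsB; have := dist_circ_le s s'.
by rewrite ltr_norml; lra.
Qed.

Lemma measurable_nbh_arg x : measurable (nbh_arg x).
Proof.
rewrite nbh_argE; apply: measurableI => //; apply: open_measurable.
have -> : [set s | dist_to (circ s) E < x] =
    (fun s => dist_to (circ s) E) @^-1` [set y | y < x] by [].
apply: open_comp; last exact: open_lt.
by move=> s _; exact: continuous_dist_circ.
Qed.

Let pi2_gt0 : 0 < pi *+ 2 :> R. Proof. by rewrite mulrn_wgt0 ?pi_gt0. Qed.

Lemma circle_measure_nbh_le x : (circle_measure (nbh x) <= (pi *+ 2)%:E)%E.
Proof.
have -> : (pi *+ 2)%:E = mu `[0, pi *+ 2[ :> \bar R.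
  by rewrite lebesgue_measure_itv/= lte_fin pi2_gt0 -EFinB subr0.
apply: le_measure; rewrite ?inE//; first exact: measurable_nbh_arg.
by rewrite -/(nbh_arg x) nbh_argE; exact: subIsetl.
Qed.

Lemma circle_measure_nbh x : circle_measure (nbh x) = (nbh_size x)%:E.
Proof.
rewrite /nbh_size fineK// ge0_fin_numE ?measure_ge0//.
exact: le_lt_trans (circle_measure_nbh_le x) (ltry _).
Qed.

Lemma nbh_size_ge0 x : 0 <= nbh_size x.
Proof. by rewrite fine_ge0// measure_ge0. Qed.

Lemma nbh_size_le x : nbh_size x <= pi *+ 2.
Proof. by rewrite -lee_fin -circle_measure_nbh circle_measure_nbh_le. Qed.

(** Each counted root brings the arc of angles from [w k] to [w (k + 1)], with [w = 2 pi / N], into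
    the neighbourhood of radius [y]; the half-open arcs are disjoint and have length [w]. *)
Lemma count_roots_le x y N : (0 < N)%N -> x + 2 * (pi *+ 2 / N%:R) <= y ->
  (\sum_(k < N) (dist_to (root_pt R k) E < x)%R%:R) / N%:R <= nbh_size y / (pi *+ 2) :> R.
Proof.
move=> N0 xy; have NR : 0 < N%:R :> R by rewrite ltr0n.
pose w : R := pi *+ 2 / N%:R; have w0 : 0 < w by rewrite divr_gt0.
pose I (k : 'I_N) : set R := `[w * k%:R, w * k.+1%:R[%classic.
have Iw k : mu (I k) = w%:E.
  rewrite lebesgue_measure_itv/= lte_fin ltr_pM2l// ltr_nat ltnSn -EFinB -mulrBr.
  by rewrite -natrB// subSnn mulr1.
have H : (\sum_(k < N | (dist_to (root_pt R k) E < x)%R) mu (I k) <= (nbh_size y)%:E)%E.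
  rewrite -measure_bigsetU_ord; first last.
  - apply/trivIsetP => i j _ _ ij; rewrite -subset0 => s []; rewrite /I/= !in_itv/=.
    move=> /andP[i1 i2] /andP[j1 j2]; move: ij; apply/negP/negPn/eqP/val_inj => /=.
    have := le_lt_trans i1 j2; have := le_lt_trans j1 i2.
    rewrite !ltr_pM2l// !ltr_nat !ltnS => ji ij; apply/eqP; by rewrite eqn_leq ij ji.
  - by move=> i; exact: measurable_itv.
  rewrite -circle_measure_nbh; apply: le_measure; rewrite ?inE.
  - by apply: bigsetU_measurable => i _; exact: measurable_itv.
  - exact: measurable_nbh_arg.
  rewrite -/(nbh_arg y).
  apply: (big_ind (fun U => U `<=` nbh_arg y)) => [//|U V HU HV s [/HU|/HV]//|k dk s].
  rewrite /I/= in_itv/= nbh_argE => /andP[s1 s2].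
  have wN : w * N%:R = pi *+ 2 by rewrite /w divfK// gt_eqF.
  split; rewrite /= ?in_itv/=.
    apply/andP; split; first by apply: le_trans s1; rewrite mulr_ge0// ltW.
    apply: lt_le_trans s2 _.
    by rewrite -wN ler_pM2l// ler_nat.
  apply: lt_le_trans xy; have := dist_to_lip E_nonempty (circ s) (root_pt R k).
  have -> : root_pt R k = circ (w * k%:R) by rewrite /root_pt /w mulrAC.
  have dk' : dist_to (circ (w * k%:R)) E < x by move: dk; rewrite /root_pt /w mulrAC.
  have := dist_circ_le s (w * k%:R); rewrite ger0_norm ?subr_ge0//.
  by move: s2; rewrite -natr1 mulrDr mulr1 -/w; lra.
move: H; rewrite (eq_bigr (fun=> w%:E)); last by move=> k _; exact: Iw.
rewrite sumEFin lee_fin => H.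
rewrite ler_pdivlMr// mulrAC -mulrA -/w mulr_suml; apply: le_trans H.
rewrite [leRHS]big_mkcond; apply: ler_sum => k _.
by case: ifP => _; rewrite ?mul1r ?mul0r.
Qed.

End CircleNeighbourhoods.

(** * Dyadic decompositions and the Ahern-Clark type *)

Section DyadicBounds.
Variables (R : realType) (E : set R[i]).
Hypotheses (E_circle : E `<=` unit_circle (R := R)) (E_nonempty : E !=set0).
Implicit Types (q x : R).

Lemma powR_invr x r : 0 <= x -> x^-1 `^ r = x `^ (- r).
Proof. by move=> x0; rewrite -powR_inv1// -powRrM mulN1r. Qed.

(** From [n] to [n + 1] the weight changes only where [dist (z, E) < 4 / 2 ^ (n + 1)], and there the
    new term alone dominates. At [n = 0] the term is present because the distance is always below
    4. *)
Lemma weight_dyadic_le q n z : 0 < q -> cabs z <= 1 ->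
  weight E q (2 ^- n) z <=
  \sum_(j < n.+1) (2 ^+ j) `^ q * (dist_to z E < 4 / 2 ^+ j)%R%:R.
Proof.
move=> q0 z1; have dz : dist_to z E < 4.
  by apply: le_lt_trans (dist_to_leD E_circle E_nonempty z) _; lra.
elim: n => [|n IH].
  rewrite big_ord1 /= expr0 divr1 dz mulr1 powR1 /weight invr1 powRN.
  rewrite invf_le1 ?powR_gt0 ?lt_max ?ltr01 ?orbT//.
  rewrite [leLHS](_ : 1 = 1 `^ q); last by rewrite powR1.
  rewrite ge0_ler_powR ?nnegrE ?(ltW q0)// ?le_max ?lexx ?ler01 ?orbT//.
rewrite big_ord_recr/=; have p0 m : 0 < 2 ^- m :> R by rewrite invr_gt0 exprn_gt0.
have pS : 2 ^- n.+1 = 2 ^- n / 2 :> R by rewrite exprSr invfM.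
have [d4|d4] := ltP (dist_to z E) (4 / 2 ^+ n.+1).
  rewrite mulr1 -[leLHS]add0r; apply: lerD.
    by apply: sumr_ge0 => j _; rewrite mulr_ge0 ?powR_ge0.
  rewrite /weight powRN -[leRHS]invrK lef_pV2 ?posrE ?invr_gt0 ?powR_gt0 ?exprn_gt0//; last first.
    by rewrite lt_max p0 orbT.
  rewrite -powRN -powR_invr ?exprn_ge0//; apply: ge0_ler_powR; rewrite ?nnegrE.
  - exact: ltW.
  - exact: ltW (p0 _).
  - by rewrite le_max (ltW (p0 _)) orbT.
  - by rewrite le_max lexx orbT.
rewrite mulr0 addr0; apply: le_trans IH; rewrite /weight.
have -> // : Num.max (dist_to z E) (2 ^- n.+1) = Num.max (dist_to z E) (2 ^- n).
have := p0 n; move: d4; rewrite pS => d4 pn.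
rewrite !max_l//; lra.
Qed.

(** The radius grows from 4 to 5 because for [N = 16 * 2 ^ n] the allowance in [count_roots_le] is
    [(pi / 4) 2 ^- n], at most [2 ^- j]. *)
Lemma mean_weight_dyadic_le q n : 0 < q ->
  mean_weight E q (2 ^- n) (16 * 2 ^ n) <=
  \sum_(j < n.+1) (2 ^+ j) `^ q * (nbh_size E (5 / 2 ^+ j) / (pi *+ 2)).
Proof.
move=> q0; set N := (16 * 2 ^ n)%N.
have N0 : (0 < N)%N by rewrite muln_gt0 expn_gt0.
have NR : 0 < N%:R :> R by rewrite ltr0n.
rewrite /mean_weight.
apply: (@le_trans _ _ ((\sum_(k < N) \sum_(j < n.+1)
    (2 ^+ j) `^ q * (dist_to (root_pt R k) E < 4 / 2 ^+ j)%R%:R) / N%:R)).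
  rewrite ler_pM2r ?invr_gt0//; apply: ler_sum => k _.
  by apply: weight_dyadic_le => //; exact: cabs_root.
rewrite exchange_big/= mulr_suml; apply: ler_sum => j _.
rewrite -mulr_sumr -mulrA ler_wpM2l ?powR_ge0//.
apply: count_roots_le => //.
have NE : N%:R = 16 * 2 ^+ n :> R by rewrite /N natrM natrX.
have pi4 : pi < 4 :> R by have := pihalf_lt2 R; lra.
have pj : 2 ^- n <= 2 ^- j :> R.
  rewrite lef_pV2 ?posrE ?exprn_gt0// ler_weXn2l ?ler1n//.
  by rewrite -ltnS ltn_ord.
have -> : 2 * (pi *+ 2 / N%:R) = pi / 4 * 2 ^- n :> R.
  by rewrite NE mulr2n; field; rewrite expf_neq0.
have p0 : 0 < 2 ^- n :> R by rewrite invr_gt0 exprn_gt0.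
by move: pj p0; move: (2 ^- n) (2 ^- j) => u v; nra.
Qed.

Lemma nbh_size_dyadic_le alpha :
  (fun x : R => nbh_size E x : R^o) =O_ (0^'+) (fun x : R => x `^ alpha : R^o) ->
  exists2 C : R, 0 < C & forall j, nbh_size E (5 / 2 ^+ j) <= C * (5 / 2 ^+ j) `^ alpha.
Proof.
move=> /eqO_exP[k k0]; rewrite near_simpl => -[d /= d0 H].
have pi2 : 0 < pi *+ 2 :> R by rewrite mulrn_wgt0 ?pi_gt0.
(* For [j >= J] the radius [5 / 2 ^ j] is below [d] and the asymptotic bound applies; the finitely
   many larger radii are covered by the trivial bound [2 pi], collected in [S]. *)
pose J := (Num.truncn (5 / d)).+1.
have g0 j : 0 < (5 / 2 ^+ j) `^ alpha :> R by rewrite powR_gt0// divr_gt0// exprn_gt0.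
pose S : R := \sum_(j < J) (pi *+ 2) / (5 / 2 ^+ j) `^ alpha.
have S0 : 0 <= S by apply: sumr_ge0 => j _; rewrite divr_ge0 ?(ltW pi2) ?(ltW (g0 _)).
exists (k + S); first by rewrite ltr_wpDr.
move=> j; have [jJ|Jj] := ltnP j J.
  apply: (le_trans (nbh_size_le E_nonempty _)); rewrite -ler_pdivrMr//.
  rewrite /S (bigD1 (Ordinal jJ))//=.
  suff : 0 <= \sum_(i < J | i != Ordinal jJ) (pi *+ 2) / (5 / 2 ^+ i) `^ alpha by lra.
  by apply: sumr_ge0 => i _; rewrite divr_ge0 ?(ltW pi2) ?(ltW (g0 _)).
have x0 : 0 < 5 / 2 ^+ j :> R by rewrite divr_gt0// exprn_gt0.
have := H (5 / 2 ^+ j); rewrite /= sub0r normrN gtr0_norm// => /(_ _ x0) {}H.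
apply: (@le_trans _ _ (k * (5 / 2 ^+ j) `^ alpha)).
  apply: le_trans (ler_norm _) _.
  rewrite -[X in k * X]ger0_norm ?powR_ge0//; apply: H.
  rewrite ltr_pdivrMr ?exprn_gt0// mulrC -ltr_pdivrMr//.
  apply: lt_trans (truncnS_gt _) _; rewrite -/J -natrX ltr_nat.
  by apply: (leq_trans (ltn_expl J (isT : 1 < 2)%N)); rewrite leq_exp2l.
by rewrite ler_wpM2r ?powR_ge0// lerDl.
Qed.

Lemma mean_weight_geometric_le q alpha : 0 < q ->
  (fun x : R => nbh_size E x : R^o) =O_ (0^'+) (fun x : R => x `^ alpha : R^o) ->
  exists2 C : R, 0 < C & forall n, mean_weight E q (2 ^- n) (16 * 2 ^ n) <=
    C * \sum_(j < n.+1) (2 `^ (q - alpha)) ^+ j.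
Proof.
move=> q0 /nbh_size_dyadic_le[C C0 H].
have pi2 : 0 < pi *+ 2 :> R by rewrite mulrn_wgt0 ?pi_gt0.
exists (C * 5 `^ alpha / (pi *+ 2)); first by rewrite divr_gt0 ?mulr_gt0 ?powR_gt0.
move=> n; apply: le_trans (mean_weight_dyadic_le n q0) _.
rewrite mulr_sumr; apply: ler_sum => j _.
have e0 : 0 < 2 ^+ j :> R by rewrite exprn_gt0.
apply: (@le_trans _ _ ((2 ^+ j) `^ q * (C * (5 / 2 ^+ j) `^ alpha / (pi *+ 2)))).
  by rewrite ler_wpM2l ?powR_ge0// ler_pM2r ?invr_gt0.
have -> : (5 / 2 ^+ j) `^ alpha = 5 `^ alpha * (2 ^+ j) `^ (- alpha) :> R.
  by rewrite powRM// ?invr_ge0 ?(ltW e0)// powR_invr ?(ltW e0).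
have -> : (2 `^ (q - alpha)) ^+ j = (2 ^+ j) `^ q * (2 ^+ j) `^ (- alpha) :> R.
  rewrite -powR_mulrn ?powR_ge0// -powRrM mulrC powRrM powR_mulrn// powRD//.
  by rewrite (gt_eqF e0) implybT.
by rewrite le_eqVlt; apply/orP; left; apply/eqP; ring.
Qed.

(** The single term with [2 ^- j <= x < 2 / 2 ^ j] already dominates. *)
Lemma powR_dyadic_le x beta J : 0 <= beta -> x < 2 -> 2 ^- J <= x ->
  x `^ beta <= \sum_(j < J.+1) (2 / 2 ^+ j) `^ beta * (2 ^- j <= x)%R%:R.
Proof.
move=> b0 x2; elim: J => [|J IH] Jx.
  rewrite big_ord1 /= Jx mulr1 expr0 divr1; rewrite expr0 invr1 in Jx.
  by rewrite ge0_ler_powR// ?nnegrE//; lra.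
rewrite big_ord_recr/= Jx mulr1.
have p0 : 0 < 2 ^- J.+1 :> R by rewrite invr_gt0 exprn_gt0.
have [/IH H|H] := leP (2 ^- J) x.
  by apply: le_trans H _; rewrite lerDl powR_ge0.
rewrite -[leLHS]add0r; apply: lerD.
  by apply: sumr_ge0 => j _; rewrite mulr_ge0 ?powR_ge0.
have E2 : 2 / 2 ^+ J.+1 = 2 ^- J :> R by rewrite exprS invfM mulrA divff ?mul1r.
apply: ge0_ler_powR; rewrite ?nnegrE ?E2//.
- by apply: ltW; exact: lt_le_trans p0 Jx.
- exact: ltW.
Qed.

Lemma ahern_clark_adherent eps : 0 < eps -> exists2 alpha,
  (fun x : R => nbh_size E x : R^o) =O_ (0^'+) (fun x : R => x `^ alpha : R^o) &
  ahern_clark_type E - eps < alpha.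
Proof.
move=> e0; rewrite /ahern_clark_type; set S := [set _ | _].
have [/(sup_adherent e0)[alpha]|/sup_out ->] := pselect (has_sup S).
  by exists alpha.
(* Without a supremum, [sup] takes the default value 0; the exponent 0 is admissible since the
   measure is at most [2 pi]. *)
exists 0; last by rewrite sub0r oppr_lt0.
apply/eqO_exP; exists (pi *+ 2); first by rewrite mulrn_wgt0 ?pi_gt0.
apply: nearW => x; rewrite powRr0 normr1 mulr1 ger0_norm ?nbh_size_ge0//.
exact: nbh_size_le.
Qed.

End DyadicBounds.

(** * Geometric sums *)

Section GeometricSums.
Variable R : realType.
Implicit Types r s : R.

Lemma geometric_le r n : 0 <= r -> r < 1 -> \sum_(j < n) r ^+ j <= (1 - r)^-1.
Proof.
move=> r0 r1; rewrite -[leRHS]mul1r ler_pdivlMr ?subr_gt0//.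
have := subrX1 r n; have : 0 <= r ^+ n by rewrite exprn_ge0.
by move: (r ^+ n) (\sum_(i < n) r ^+ i) => u v; lra.
Qed.

(** Comparison with a ratio [s > 1] treats [r < 1], [r = 1] and [r > 1] together. *)
Lemma geometric_ge1_le r s n : 0 <= r -> r <= s -> 1 < s ->
  \sum_(j < n) r ^+ j <= s ^+ n / (s - 1).
Proof.
move=> r0 rs s1; apply: (@le_trans _ _ (\sum_(j < n) s ^+ j)).
  by apply: ler_sum => j _; rewrite lerXn2r ?nnegrE//; lra.
rewrite ler_pdivlMr ?subr_gt0//; have := subrX1 s n.
by move: (s ^+ n) (\sum_(i < n) s ^+ i) => u v; lra.
Qed.

Lemma ltr_powR2 (x y : R) : x < y -> 2 `^ x < 2 `^ y :> R.
Proof.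
by move=> xy; rewrite /powR gt_eqF// ltr_expR ltr_pM2r// ln_gt0// ltr1n.
Qed.

End GeometricSums.

(** * Weighted sums over finitely many zeros *)

Section ZeroSums.
Variables (R : realType) (E : set R[i]).
Hypotheses (E_circle : E `<=` unit_circle (R := R)) (E_nonempty : E !=set0).
Implicit Types (f : R[i] -> R[i]) (K : R) (A : seq R[i]) (m : R[i] -> nat).

Definition controlled q f K := [/\ holomorphic_on_disc f, cabs (f 0) = 1, 0 < K &
  forall z, unit_disc z -> logp (cabs (f z)) <= K / dist_to z E `^ q].

Definition divisible_at f a k := exists2 g, holomorphic_on_disc g &
  forall z, unit_disc z -> f z = (z - a) ^+ k * g z.

(** [m a] is any exponent for which divisibility holds, not necessarily the multiplicity: the bounds
    then also show that multiplicities are finite. *)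
Definition zero_data f A m := [/\ uniq A, forall a, a \in A -> zeros f a &
  forall a, a \in A -> divisible_at f a (m a)].

Lemma zero_data_filter f A m (P : pred R[i]) :
  zero_data f A m -> zero_data f [seq a <- A | P a] m.
Proof.
move=> [uA zA dA]; split; first exact: filter_uniq.
- by move=> a; rewrite mem_filter => /andP[_ /zA].
- by move=> a; rewrite mem_filter => /andP[_ /dA].
Qed.

(** This is [zero_sum_bound] at [t = 2 ^- (n + 5)], so that [32 t = 2 ^- n]. The term [j = 0] makes
    the geometric sum at least 1, which absorbs the isolated [K]. *)
Lemma zero_level_bound (q alpha : R) : 0 < q ->
  (fun x : R => nbh_size E x : R^o) =O_ (0^'+) (fun x : R => x `^ alpha : R^o) ->
  exists2 C : R, 0 < C & forall f K A m n, controlled q f K -> zero_data f A m ->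
    (forall a, a \in A -> 2 ^- n <= dist_to a E) ->
    \sum_(a <- A) (m a)%:R * (1 - cabs a ^+ 2) <=
    C * K * \sum_(j < n.+1 + 5) (2 `^ (q - alpha)) ^+ j.
Proof.
move=> q0 /(mean_weight_geometric_le E_circle E_nonempty q0)[C C0 HC].
have D0 : 0 < 100 * 4 `^ q * C by rewrite !mulr_gt0// powR_gt0.
exists (4 * (1 + 100 * 4 `^ q * C)); first lra.
move=> f K A m n [fh f0 K0 fK] [uA zA dA] An.
set S := \sum_(j < _) _.
have S1 : 1 <= S.
  rewrite /S addSn big_ord_recl expr0 lerDl.
  by apply: sumr_ge0 => j _; rewrite exprn_ge0 ?powR_ge0.
have e5 : 2 ^- (n + 5) = 2 ^- n / 32 :> R.
  by rewrite exprD invfM; congr (_ * _^-1); ring.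
have p0 : 0 < 2 ^- n :> R by rewrite invr_gt0 exprn_gt0.
have p1 : 2 ^- n <= 1 :> R by rewrite invf_le1 ?exprn_gt0// exprn_ege1// ler1n.
have := @zero_sum_bound R E E_circle E_nonempty q (2 ^- (n + 5)) K (16 * 2 ^ (n + 5)) f A m q0.
move=> /(_ ltac:(rewrite e5; lra) ltac:(rewrite e5; lra) K0).
move=> /(_ ltac:(by rewrite natrM natrX mulfK// expf_neq0)).
move=> /(_ fh f0 fK uA zA) H; apply: le_trans (H _ dA) _.
  by move=> a /An; rewrite e5; lra.
have := HC (n + 5)%N; rewrite -addSn -/S; set M := mean_weight _ _ _ _ => HM.
have H1 : 100 * 4 `^ q * K * M <= 100 * 4 `^ q * C * K * S.
  have -> : 100 * 4 `^ q * C * K * S = 100 * 4 `^ q * K * (C * S) by ring.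
  by rewrite ler_wpM2l// !mulr_ge0 ?powR_ge0// ltW.
have H2 : K <= K * S by rewrite ler_peMr// ltW.
lra.
Qed.

Lemma dyadic_lower_bound A : (forall a, a \in A -> cabs a < 1) ->
  exists n, forall a, a \in A -> 2 ^- n <= dist_to a E.
Proof.
elim: A => [|a A IH] H; first by exists 0%N.
have [|n Hn] := IH; first by move=> b bA; apply: H; rewrite in_cons bA orbT.
have d0 : 0 < dist_to a E.
  apply: lt_le_trans (dist_to_ge E_circle E_nonempty a).
  by rewrite subr_gt0 H// mem_head.
pose k := (Num.truncn (dist_to a E)^-1).+1.
have mono i j : (i <= j)%N -> 2 ^- j <= 2 ^- i :> R.
  by move=> ij; rewrite lef_pV2 ?posrE ?exprn_gt0// ler_weXn2l// ler1n.
exists (maxn n k) => b; rewrite in_cons => /predU1P[->|/Hn]; last first.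
  by apply: le_trans; apply: mono; exact: leq_maxl.
apply: (le_trans (mono k _ (leq_maxr _ _))).
rewrite -[leRHS]invrK lef_pV2 ?posrE ?exprn_gt0 ?invr_gt0//; apply: ltW.
apply: lt_trans (truncnS_gt _) _; rewrite -/k -natrX ltr_nat.
exact: ltn_expl.
Qed.

Let term beta m a := (m a)%:R * ((1 - cabs a ^+ 2) * dist_to a E `^ beta) : R.

(** For [q < alpha] the geometric sums are bounded independently of the level, so a single level
    reaching all the zeros suffices. *)
Lemma zero_sum_beta0 (q alpha : R) : 0 < q -> q < alpha ->
  (fun x : R => nbh_size E x : R^o) =O_ (0^'+) (fun x : R => x `^ alpha : R^o) ->
  exists2 c : R, 0 < c & forall f K A m, controlled q f K -> zero_data f A m ->
    \sum_(a <- A) term 0 m a <= c * K.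
Proof.
move=> q0 qa /(zero_level_bound q0)[C C0 HC].
have r1 : 2 `^ (q - alpha) < 1 :> R.
  by rewrite -[ltRHS](powRr0 (2 : R)) ltr_powR2// subr_lt0.
exists (C / (1 - 2 `^ (q - alpha))); first by rewrite divr_gt0// subr_gt0.
move=> f K A m cK zd; have [_ _ K0 _] := cK.
have [n An] := @dyadic_lower_bound A (fun a aA => (let: And3 _ zA _ := zd in (zA a aA).1)).
under eq_bigr do rewrite /term powRr0 mulr1.
apply: le_trans (HC f K A m n cK zd An) _.
rewrite [leRHS]mulrAC ler_wpM2l ?mulr_ge0 ?(ltW C0) ?(ltW K0)//.
by apply: geometric_le => //; exact: powR_ge0.
Qed.

(** [powR_dyadic_le] distributes the weight over the levels [2 ^- j <= dist (a, E)] with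
    coefficients of order [s ^- j], where [s = 2 ^ beta]. The level bound grows essentially like
    [r ^ j] with [r = 2 ^ (q - alpha) < s], so the series over the levels converges. *)
Lemma zero_sum_beta_gt0 (q alpha beta : R) : 0 < q -> 0 < beta -> q - alpha < beta ->
  (fun x : R => nbh_size E x : R^o) =O_ (0^'+) (fun x : R => x `^ alpha : R^o) ->
  exists2 c : R, 0 < c & forall f K A m, controlled q f K -> zero_data f A m ->
    \sum_(a <- A) term beta m a <= c * K.
Proof.
move=> q0 b0 qab /(zero_level_bound q0)[C C0 HC].
set r := 2 `^ (q - alpha) in HC.
have r0 : 0 <= r by exact: powR_ge0.
pose s : R := 2 `^ beta.
have s1 : 1 < s by rewrite /s -[ltLHS](powRr0 (2 : R)) ltr_powR2.
have rs : r < s by exact: ltr_powR2.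
(* A ratio at least [r] and strictly between 1 and [s]: [geometric_ge1_le] needs [r' > 1], the
   summation over levels needs [r' < s]. *)
pose r' := Num.max r ((1 + s) / 2).
have r'1 : 1 < r' by rewrite lt_max; apply/orP; right; lra.
have r's : r' < s by rewrite gt_max rs/=; lra.
have rr' : r <= r' by rewrite le_max lexx.
have rs1 : r' / s < 1 by rewrite ltr_pdivrMr ?mul1r//; lra.
have rs0 : 0 <= r' / s by rewrite divr_ge0; lra.
(* The power 6 comes from the [j.+1 + 5] terms of the geometric sum at level [j]. *)
pose c := s * C * (r' ^+ 6 / (r' - 1)) / (1 - r' / s).
have c0 : 0 < c.
  rewrite /c divr_gt0 ?subr_gt0// mulr_gt0//; first by rewrite mulr_gt0//; lra.
  by rewrite divr_gt0 ?subr_gt0// exprn_gt0//; lra.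
exists c => // f K A m cK zd; have [_ _ K0 _] := cK; have [uA zA dA] := zd.
have A1 a : a \in A -> cabs a < 1 by move=> /zA[].
have [J AJ] := dyadic_lower_bound A1.
have m0 a : a \in A -> 0 <= (m a)%:R * (1 - cabs a ^+ 2) :> R.
  by move=> aA; rewrite mulr_ge0// subr_ge0 exprn_ile1 ?cabs_ge0// ltW// A1.
apply: (@le_trans _ _ (\sum_(a <- A) \sum_(j < J.+1) (2 / 2 ^+ j) `^ beta *
    ((m a)%:R * (1 - cabs a ^+ 2) * (2 ^- j <= dist_to a E)%R%:R))).
  rewrite big_seq [leRHS]big_seq; apply: ler_sum => a aA.
  rewrite /term mulrA.
  have x2 : dist_to a E < 2.
    by apply: le_lt_trans (dist_to_leD E_circle E_nonempty a) _; have := A1 a aA; lra.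
  apply: (le_trans (ler_wpM2l (m0 a aA) (powR_dyadic_le (ltW b0) x2 (AJ a aA)))).
  by rewrite mulr_sumr; apply: ler_sum => j _; rewrite mulrCA.
rewrite exchange_big/=.
apply: (@le_trans _ _ (\sum_(j < J.+1) s * C * K * (r' ^+ 6 / (r' - 1)) * (r' / s) ^+ j)).
  apply: ler_sum => j _; rewrite -mulr_sumr.
  have -> : (2 / 2 ^+ j) `^ beta = s / s ^+ j.
    rewrite powRM// ?invr_ge0 ?exprn_ge0// -/s; congr (_ * _).
    rewrite powR_invr ?exprn_ge0// powRN; congr (_^-1).
    by rewrite /s -powR_mulrn// -powRrM mulrC powRrM powR_mulrn// powR_ge0.
  rewrite expr_div_n.
  have -> : s * C * K * (r' ^+ 6 / (r' - 1)) * (r' ^+ j / s ^+ j) =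
    s / s ^+ j * (C * K * (r' ^+ (j.+1 + 5) / (r' - 1))).
    by rewrite addSn -addnS exprD; ring.
  rewrite ler_wpM2l ?divr_ge0 ?exprn_ge0//; try lra.
  apply: (@le_trans _ _ (C * K * \sum_(i < j.+1 + 5) r ^+ i)); last first.
    by rewrite ler_wpM2l ?mulr_ge0 ?(ltW C0) ?(ltW K0)// geometric_ge1_le.
  have Aj a : a \in [seq a <- A | 2 ^- j <= dist_to a E] -> 2 ^- j <= dist_to a E.
    by rewrite mem_filter => /andP[].
  have := HC f K _ m j cK (zero_data_filter (fun a => 2 ^- j <= dist_to a E) zd) Aj.
  apply: le_trans; rewrite big_filter [leRHS]big_mkcond.
  by apply: ler_sum => a _; case: ifP; rewrite ?mulr1 ?mulr0.
rewrite -mulr_sumr.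
have -> : c * K = s * C * K * (r' ^+ 6 / (r' - 1)) * (1 - r' / s)^-1.
  by rewrite /c; ring.
rewrite ler_wpM2l ?geometric_le//.
have sC : 0 <= s * C by rewrite mulr_ge0//; lra.
have r'6 : 0 <= r' ^+ 6 by rewrite exprn_ge0//; lra.
by rewrite !mulr_ge0 ?invr_ge0//; lra.
Qed.

(** Choose an admissible [alpha] above the type minus [eps]. If the exponent is positive, it exceeds
    [q - alpha]; otherwise [q < alpha]. *)
Lemma zero_sum_finite (q eps : R) : 0 < q -> 0 < eps ->
  exists2 c : R, 0 < c & forall f K A m, controlled q f K -> zero_data f A m ->
    \sum_(a <- A) term (Num.max (q - ahern_clark_type E + eps) 0) m a <= c * K.
Proof.
move=> q0 e0; have [alpha Oa ale] := ahern_clark_adherent E_nonempty e0.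
have [b0|b0] := ltP 0 (q - ahern_clark_type E + eps).
  by apply: (zero_sum_beta_gt0 q0 b0 _ Oa); lra.
by apply: (zero_sum_beta0 q0 _ Oa); lra.
Qed.

End ZeroSums.

(** * Finiteness of multiplicities and passage to all the zeros *)

Theorem theorem1p5 (R : realType) (E : set R[i])
    (E_circle : E `<=` unit_circle (R := R))
    (E_closed : closed (E : set R[i]^o))
    (E_nonempty : E !=set0)
    (q eps : R) (q_gt0 : 0 < q) (eps_gt0 : 0 < eps) :
  exists c : R, 0 < c /\
    forall (f : R[i] -> R[i]) (K : R),
      holomorphic_on_disc f ->
      cabs (f 0) = 1 ->
      0 < K ->
      (forall z : R[i], unit_disc z ->
         logp (cabs (f z)) <= K / dist_to z E `^ q) ->
      (\esum_(a in zeros f)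
         (zero_mult f a *
          ((1 - cabs a ^+ 2) *
           dist_to a E `^ Num.max (q - ahern_clark_type E + eps) 0)%R%:E)
       <= (c * K)%:E)%E.
Proof.
have [c c0 H] := zero_sum_finite E_circle E_nonempty q_gt0 eps_gt0.
exists c; split=> // f K fh f0 K0 fK.
have cK : controlled E q f K by [].
move: H; set beta := Num.max _ _ => H.
pose w a := (1 - cabs a ^+ 2) * dist_to a E `^ beta.
have w0 a : zeros f a -> 0 < w a.
  move=> [a1 _]; have da := dist_to_ge E_circle E_nonempty a.
  rewrite /unit_disc/= in a1; rewrite mulr_gt0 ?powR_gt0//; last lra.
  by rewrite subr_gt0 exprn_ilt1// ?cabs_ge0.
(* The bound for the one-point family [[:: a]] limits every [k] such that [(z - a) ^ k] divides [f];
   hence the supremum defining [zero_mult] is a natural number and is attained. *)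
have multE a : exists k : nat, zeros f a ->
    zero_mult f a = k%:R%:E /\ divisible_at f a k.
  have [za|] := pselect (zeros f a); last by exists 0%N.
  have bd k : `[< divisible_at f a k >] -> (k <= Num.truncn (c * K / w a))%N.
    move=> /asboolP dk.
    have zd : zero_data f [:: a] (fun=> k) by split=> // b; rewrite inE => /eqP->.
    have := H f K [:: a] (fun=> k) cK zd; rewrite big_seq1 -/(w a) -ler_pdivlMr ?w0//.
    by rewrite truncn_ge_nat// divr_ge0 ?(ltW (w0 _ za))// mulr_ge0 ?(ltW c0) ?(ltW K0).
  have ex0 : exists k, `[< divisible_at f a k >].
    by exists 0%N; apply/asboolP; exists f => // z _; rewrite expr0 mul1r.
  case: (ex_maxnP ex0 bd) => k /asboolP dk kmax; exists k => _; split => //.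
  apply/eqP; rewrite eq_le; apply/andP; split.
    apply: ge_ereal_sup => _ [j dj <-]; rewrite lee_fin ler_nat.
    by apply: kmax; exact/asboolP.
  by apply: ereal_sup_ubound; exists k.
have [m Hm] := choice multE.
(* The sum is a supremum over finite sets of zeros, all subject to the same bound. *)
apply: ge_ereal_sup => _ [A [finA Az] <-].
rewrite fsbig_finite//=.
have mem a : a \in finmap.enum_fset (fset_set A) -> zeros f a.
  by rewrite in_fset_set// inE => /Az.
rewrite (eq_big_seq (fun a => ((m a)%:R * w a)%:E)); last first.
  by move=> a /mem za; rewrite (Hm a za).1.
rewrite sumEFin lee_fin; apply: (H f K _ m cK); split; first exact: finmap.fset_uniq.
- exact: mem.
- by move=> a /mem za; exact: (Hm a za).2.
Qed.
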